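(* Let $\mathcal{A}$ be a (not necessarily unital) complex $*$-algebra and let $v,w\in\mathcal{A}_R^{\dag}$ be representable functionals on $\mathcal{A}$. Let $w_s:=\lim_{n\to\infty}\widetilde{\mu}_v^{[n]}(w)$ be the pointwise limit, where $\widetilde{\mu}_v^{[0]}(w):=w$, $\widetilde{\mu}_v^{[n+1]}(w):=\widetilde{\mu}_v(\widetilde{\mu}_v^{[n]}(w))$ and $\widetilde{\mu}_v(u):=u-u:v$, with $:$ denoting the parallel sum of representable functionals. Then $w=w_s+(w-w_s)$ is a Lebesgue-type decomposition of $w$ with respect to $v$ (that is, $w_s$ and $v$ are mutually singular and $w-w_s\ll v$); moreover $$w-w_s=\max\{u\in\mathcal{A}_R^{\dag}\,:\,u\le w,\ u\ll v\},$$ the maximum (largest element) being taken with respect to $\le$.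
   Context: A linear functional $w:\mathcal{A}\to\mathbb{C}$ is positive if $w(a^*a)\ge0$ for all $a\in\mathcal{A}$; for positive functionals, $w\le v$ means that $v-w$ is a positive functional. $w$ is representable if there are a Hilbert space $\mathcal{H}_w$, a $*$-representation $\pi_w:\mathcal{A}\to\mathcal{B}(\mathcal{H}_w)$ by bounded operators and a vector $\zeta_w\in\mathcal{H}_w$ with $w(a)=(\pi_w(a)\zeta_w\,|\,\zeta_w)$ for all $a\in\mathcal{A}$. $\mathcal{A}_R^{\dag}$ denotes the set of representable functionals, partially ordered by $\le$; representable functionals are positive. For $w,v\in\mathcal{A}_R^{\dag}$: $w\ll v$ ($w$ is absolutely continuous with respect to $v$) means that for every sequence $(a_n)$ in $\mathcal{A}$, $v(a_n^*a_n)\to0$ and $w((a_n-a_m)^*(a_n-a_m))\to0$ (as $n,m\to\infty$) imply $w(a_n^*a_n)\to0$. $w$ and $v$ are mutually singular if $u\in\mathcal{A}_R^{\dag}$, $u\le w$, $u\le v$ imply $u=0$. The parallel sum $w:v$ of $w,v\in\mathcal{A}_R^{\dag}$ is the unique representable functional satisfying $(w:v)(a^*a)=\inf\{w(b^*b)+v(c^*c): b,c\in\mathcal{A},\ b+c=a\}$ for every $a\in\mathcal{A}$; it exists. The map $\widetilde{\mu}_v$ sends $\mathcal{A}_R^{\dag}$ into $\mathcal{A}_R^{\dag}$, and the pointwise limit $w_s$ exists and is a representable functional. *)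

(* Defs.v *)
From HB Require Import structures.
From mathcomp Require Import all_boot all_order all_algebra sesquilinear.
From mathcomp Require Import all_classical all_reals all_analysis.
From mathcomp Require Import complex.

Set Implicit Arguments.
Unset Strict Implicit.
Unset Printing Implicit Defensive.

Import Order.TTheory GRing.Theory Num.Theory.
Import numFieldNormedType.Exports.

Local Open Scope classical_set_scope.
Local Open Scope ring_scope.
Local Open Scope complex_scope.

(* The standard topology of the complex numbers, given by the modulus. *)
HB.instance Definition _ (R : realType) := GRing.ComAlgebra.copy R[i] R[i]^o.
HB.instance Definition _ (R : realType) := Vector.copy R[i] R[i]^o.
HB.instance Definition _ (R : realType) := NormedModule.copy R[i] R[i]^o.

(* No unit is assumed, so the product cannot come from a ring structure. *)
HB.mixin Record Lmodule_isStarAlgebra (R : realType) A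
    & GRing.Lmodule R[i] A := {
  smul : A -> A -> A;
  star : A -> A;
  smulA : forall a b c : A, smul a (smul b c) = smul (smul a b) c;
  smulDl : forall a b c : A, smul (a + b) c = smul a c + smul b c;
  smulDr : forall a b c : A, smul a (b + c) = smul a b + smul a c;
  smulZl : forall (k : R[i]) (a b : A), smul (k *: a) b = k *: smul a b;
  smulZr : forall (k : R[i]) (a b : A), smul a (k *: b) = k *: smul a b;
  starK : forall a : A, star (star a) = a;
  starD : forall a b : A, star (a + b) = star a + star b;
  starZ : forall (k : R[i]) (a : A), star (k *: a) = Num.conj k *: star a;
  starM : forall a b : A, star (smul a b) = smul (star b) (star a)
}.

#[short(type="starAlgType")]
HB.structure Definition StarAlgebra (R : realType) :=
  {A of GRing.Lmodule R[i] A & Lmodule_isStarAlgebra R A}.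

HB.mixin Record CompleteNormedModule_isHilbert (R : realType) H
    & CompleteNormedModule R[i] H := {
  inner : {dot H for Num.conj};
  innerE : forall x : H, inner x x = `|x| ^+ 2
}.

#[short(type="hilbertType")]
HB.structure Definition Hilbert (R : realType) :=
  {H of CompleteNormedModule R[i] H & CompleteNormedModule_isHilbert R H}.

Section Functionals.
Variables (R : realType) (A : starAlgType R).
Implicit Types (u v w : A -> R[i]) (a b c : A).

Definition bounded_operator (H : hilbertType R) (T : {linear H -> H}) : Prop :=
  exists M : R[i], forall x : H, `|T x| <= M * `|x|.

Definition star_representation (H : hilbertType R)
    (pi : A -> {linear H -> H}) : Prop :=
  [/\ forall a, bounded_operator (pi a),
      forall (k : R[i]) a b (x : H), pi (k *: a + b) x = k *: pi a x + pi b x,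
      forall a b (x : H), pi (smul a b) x = pi a (pi b x)
    & forall a (x y : H), inner (pi a x) y = inner x (pi (star a) y)].

Definition representable : set (A -> R[i]) := [set w |
  exists (H : hilbertType R) (pi : A -> {linear H -> H}) (zeta : H),
    star_representation pi /\ forall a, w a = inner (pi a zeta) zeta].

Definition sqval w a : R[i] := w (smul (star a) a).

Definition positive_functional w : Prop :=
  scalar w /\ forall a, 0 <= sqval w a.

Definition fun_le w v : Prop := positive_functional (v - w).

Definition abs_continuous w v : Prop := forall a_ : nat -> A,
  sqval v (a_ n) @[n --> \oo] --> (0 : R[i]) ->
  sqval w (a_ p.1 - a_ p.2) @[p --> (\oo, \oo)] --> (0 : R[i]) ->
  sqval w (a_ n) @[n --> \oo] --> (0 : R[i]).

Definition mutually_singular w v : Prop :=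
  forall u, representable u -> fun_le u w -> fun_le u v -> u = 0.

(* The values on the squares are nonnegative, so the infimum is taken over the
   reals and embedded back into R[i]. *)
Definition is_parallel_sum w v u : Prop :=
  representable u /\ forall a, sqval u a =
    (inf [set r : R | exists b c, b + c = a /\
            r = complex.Re (sqval w b + sqval v c)])%:C.

(* For representable w and v there is exactly one u with is_parallel_sum w v u;
   xget selects it, the default 0 being used only outside that case. *)
Definition parallel_sum w v : A -> R[i] := xget 0 (is_parallel_sum w v).

Definition mu_tilde v u : A -> R[i] := u - parallel_sum u v.

Definition singular_part v w : A -> R[i] :=
  fun a => lim (iter n (mu_tilde v) w a @[n --> \oo]).

(* Absolute continuity and mutual singularity relate representable functionals,
   hence the two representability clauses. *)
Definition lebesgue_decomposition w v ws wr : Prop :=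
  [/\ representable ws, representable wr, w = ws + wr,
      mutually_singular ws v & abs_continuous wr v].

Definition is_maximum (S : set (A -> R[i])) u : Prop :=
  S u /\ forall u', S u' -> fun_le u' u.

End Functionals.

(* Main.v *)
Require Import Defs.
From HB Require Import structures.
From mathcomp Require Import all_boot all_order all_algebra sesquilinear.
From mathcomp Require Import all_classical all_reals all_analysis.
From mathcomp Require Import complex ring lra.

Set Implicit Arguments.
Unset Strict Implicit.
Unset Printing Implicit Defensive.

Import Order.TTheory GRing.Theory Num.Theory.
Import numFieldNormedType.Exports.

Local Open Scope classical_set_scope.
Local Open Scope ring_scope.
Local Open Scope complex_scope.

(** Write w and v as vector functionals of representations pi1 on H1 and pi2
    on H2 with vectors x1 and x2, put pi = pi1 + pi2 on the orthogonal sum K of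
    H1 and H2, zeta = (x1, x2), J a = pi a zeta, and let G be the closure of
    the range of J.  Then w(a^* a) and v(a^* a) are the squared norms of the two
    components of J a: G is the closed graph of the relation that compares the
    two GNS maps.  Let Q be the projection onto G, E1 the projection onto the
    first summand, and W = Q E1 Q.  On G the forms of w and v are those of the
    operators W and 1 - W, which commute; this is what makes the iteration
    computable.

    - The parallel sum of two representable functionals exists because its
      defining infimum is the squared distance from a vector to an invariant
      closed subspace (parallel_sum_exists).  The orthogonal splitting of that
      vector represents both u : v and u - u : v.

    - On G the step u |-> u - u : v becomes T |-> T (T + 1 - W)^-1 T
      (admissible_step), since the infimum is a completed square.  The operator
      T + 1 - W stays bounded below along the iteration, so only inverses of
      coercive operators are needed.  The iterates T_n started at W decrease,
      commute with whatever commutes with W, and fix N = ker (1 - W).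

    - With V = 1 - W, each step drops the form by at least half of
      (T_n V y, V y) (parallel_step_drop).  The drops are summable, so T_n tends
      to 0 on the closure of the range of V, the orthogonal complement of N.
      Hence the forms of the T_n decrease to that of the projection P onto N
      (iterate_limit).

    - A representable functional is determined by its values on the squares
      a^* a (representable_determined), so the iterates of w are
      a |-> (T_n J a | zeta), and they converge pointwise to the functional
      a |-> (pi a (P zeta) | P zeta), which is therefore w_s.

    - N consists of the vectors of G whose second component vanishes.  Given a,
      choose b_n with J b_n --> P (J a): then v(b_n^* b_n) --> 0.  The
      functional w - w_s is represented by (E1 - P) zeta.  A functional below
      both w_s and v is small on a - b_n and on b_n, which gives singularity.
      A limit of (E1 - P) J a_n with v(a_n^* a_n) --> 0 lies in N and is
      orthogonal to N, which gives absolute continuity.  Finally, u <= w with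
      u << v forces u(b_n^* b_n) --> 0, whence
      u(a^* a) <= lim w((a - b_n)^* (a - b_n)) = (w - w_s)(a^* a). *)

(** * Real semi-inner products on complex vector spaces *)

Section RealForms.
Variables (R : realType) (V : lmodType R[i]).
Implicit Types (q : V -> V -> R) (x y z : V) (k : R).

(** Order and estimates live in R, so complex inner products are used through
    their real parts; every positive symmetric operator gives such a form. *)
Record real_form q : Prop := RealForm {
  rfDl : forall x y z, q (x + y) z = q x z + q y z;
  rfZl : forall k x y, q (k%:C *: x) y = k * q x y;
  rfC : forall x y, q x y = q y x;
  rf_ge0 : forall x, 0 <= q x x }.

Variable q : V -> V -> R.
Hypothesis qP : real_form q.

Lemma rfDr x y z : q x (y + z) = q x y + q x z.
Proof. by rewrite rfC // rfDl // !(rfC qP x). Qed.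

Lemma rfZr k x y : q x (k%:C *: y) = k * q x y.
Proof. by rewrite rfC // rfZl // (rfC qP x). Qed.

Lemma rfNl x y : q (- x) y = - q x y.
Proof.
have -> : - x = (-1)%:C *: x by rewrite rmorphN rmorph1 scaleN1r.
by rewrite rfZl // mulN1r.
Qed.

Lemma rfNr x y : q x (- y) = - q x y.
Proof. by rewrite rfC // rfNl (rfC qP x). Qed.

Lemma rf_sqD x y : q (x + y) (x + y) = q x x + 2 * q x y + q y y.
Proof. rewrite rfDl // !rfDr (rfC qP y x); ring. Qed.

Lemma rf_sqB x y : q (x - y) (x - y) = q x x - 2 * q x y + q y y.
Proof. by rewrite rf_sqD !rfNr rfNl opprK; ring. Qed.

Lemma rf_CauchySchwarz x y : q x y ^+ 2 <= q x x * q y y.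
Proof.
have h1 := rf_ge0 qP ((q y y)%:C *: x - (q x y)%:C *: y).
have h2 := rf_ge0 qP ((q x x)%:C *: y - (q x y)%:C *: x).
have h3 := rf_ge0 qP (x + y); have h4 := rf_ge0 qP (x - y).
rewrite rf_sqB !rfZl // !rfZr in h1; rewrite rf_sqB !rfZl // !rfZr in h2.
rewrite rf_sqD in h3; rewrite rf_sqB in h4.
rewrite (rfC qP y x) in h2.
have := rf_ge0 qP x; have := rf_ge0 qP y.
move: (q x x) (q x y) (q y y) h1 h2 h3 h4 => a b c h1 h2 h3 h4 c0 a0.
have [cpos|c_le0] := ltP 0 c.
  by rewrite -(ler_pM2l cpos); nra.
have [apos|a_le0] := ltP 0 a.
  by rewrite -(ler_pM2l apos); nra.
have a0' : a = 0 by lra.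
have c0' : c = 0 by lra.
subst a c; have -> : b = 0 by lra.
by rewrite expr2 !mul0r.
Qed.

Lemma rf_Minkowski x y :
  Num.sqrt (q (x + y) (x + y)) <= Num.sqrt (q x x) + Num.sqrt (q y y).
Proof.
rewrite -(@ler_pXn2r _ 2) ?nnegrE ?addr_ge0 ?sqrtr_ge0 //.
rewrite sqrrD !sqr_sqrtr ?rf_ge0 // rf_sqD lerD2r lerD2l.
rewrite -sqrtrM ?rf_ge0 // mulr2n -[X in _ <= X]mulr2n -mulr_natl.
rewrite ler_pM2l ?ltr0n // (le_trans (ler_norm _)) // -sqrtr_sqr.
exact/ler_wsqrtr/rf_CauchySchwarz.
Qed.

Lemma rf_sqD_le x y : q (x + y) (x + y) <= 2 * (q x x + q y y).
Proof. by have := rf_ge0 qP (x - y); rewrite rf_sqB rf_sqD; lra. Qed.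

End RealForms.

(** * Hilbert spaces and their orthogonal sums *)

Section HilbertBasics.
Variables (R : realType) (H : hilbertType R).
Implicit Types (x y z : H) (k : R[i]).
Local Open Scope complex_scope.

Definition rdot x y : R := complex.Re (inner x y).
Definition nrm2 x : R := rdot x x.

Lemma innerDl x y z : inner (x + y) z = inner x z + inner y z.
Proof. exact: linearDl. Qed.

Lemma innerZl k x y : inner (k *: x) y = k * inner x y.
Proof. exact: linearZl_LR. Qed.

Lemma innerC x y : inner x y = (inner y x)^*.
Proof. by rewrite hermC expr0 mul1r. Qed.

Lemma innerDr x y z : inner x (y + z) = inner x y + inner x z.
Proof. exact: linearDr. Qed.

Lemma innerZr k x y : inner x (k *: y) = k^* * inner x y.
Proof. exact: linearZr_LR. Qed.


Lemma innerNl x y : inner (- x) y = - inner x y.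
Proof. exact: linearNl. Qed.

Lemma innerNr x y : inner x (- y) = - inner x y.
Proof. exact: linearNr. Qed.

Lemma innerxx x : inner x x = (nrm2 x)%:C.
Proof.
rewrite /nrm2 /rdot innerE.
have /ger0_real/RRe_real <- : 0 <= `|x| by [].
by rewrite -rmorphXn.
Qed.

Lemma nrm2_norm x : (nrm2 x)%:C = `|x| ^+ 2.
Proof. by rewrite -innerxx innerE. Qed.

Lemma rdot_form : real_form rdot.
Proof.
split=> [x y z|k x y|x y|x].
- by rewrite /rdot innerDl raddfD.
- by rewrite /rdot innerZl; case: (inner x y) => a b /=; rewrite mul0r subr0.
- by rewrite /rdot innerC; case: (inner y x).
- by rewrite -ler0c -/(nrm2 x) nrm2_norm exprn_ge0.
Qed.

Lemma nrm2_ge0 x : 0 <= nrm2 x.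
Proof. exact: rf_ge0 rdot_form _. Qed.

Lemma nrm2_eq0 x : nrm2 x = 0 -> x = 0.
Proof.
move=> hx; have : (nrm2 x)%:C = 0 by rewrite hx.
by rewrite nrm2_norm => /eqP; rewrite sqrf_eq0 normr_eq0 => /eqP.
Qed.

Lemma nrm2Z k x : nrm2 (k *: x) = complex.Re (k * k^*) * nrm2 x.
Proof.
have : (nrm2 (k *: x))%:C = k * k^* * (nrm2 x)%:C.
  by rewrite -!innerxx innerZl innerZr mulrA.
by case: k => a b [-> _] /=; rewrite mulr0 subr0.
Qed.

(** The real part of an inner product recovers the imaginary one. *)
Lemma inner_rdot x y : inner x y = Complex (rdot x y) (rdot x ('i *: y)).
Proof.
rewrite /rdot innerZr; case: (inner x y) => a b /=.
by congr (Complex _ _); rewrite !mul0r mulN1r sub0r opprK.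
Qed.

Lemma inner_eq0P x y : rdot x y = 0 -> rdot x ('i *: y) = 0 -> inner x y = 0.
Proof. by rewrite inner_rdot => -> ->. Qed.

Lemma normr_nrm2 x : `|x| = (Num.sqrt (nrm2 x))%:C.
Proof.
apply/eqP; rewrite -(@eqrXn2 _ 2) ?ler0c ?sqrtr_ge0 //.
by rewrite -nrm2_norm -rmorphXn /= sqr_sqrtr ?nrm2_ge0.
Qed.

End HilbertBasics.

Section HilbertSum.
Variables (R : realType) (H1 H2 : hilbertType R).

(** A separate name keeps this type apart from the product, whose norm is the
    maximum of the norms of the components. *)
Definition hsum : Type := (H1 * H2)%type.

HB.instance Definition _ := GRing.Lmodule.copy hsum (H1 * H2)%type.

Definition hsum_inner (x y : hsum) : R[i] := inner x.1 y.1 + inner x.2 y.2.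

Let hsum_rdot (x y : hsum) := complex.Re (hsum_inner x y).

Lemma hsum_rdot_form : real_form hsum_rdot.
Proof.
have E x y : hsum_rdot x y = rdot x.1 y.1 + rdot x.2 y.2.
  by rewrite /hsum_rdot /hsum_inner raddfD.
split=> [x y z|k x y|x y|x]; rewrite !E.
- by rewrite !(rfDl (rdot_form _)) addrACA.
- by rewrite !(rfZl (rdot_form _)) mulrDr.
- by rewrite (rfC (rdot_form _)) (rfC (rdot_form _) x.2).
- by rewrite addr_ge0 ?nrm2_ge0.
Qed.

Definition hsum_norm (x : hsum) : R[i] := (Num.sqrt (nrm2 x.1 + nrm2 x.2))%:C.

Lemma hsum_normE x : hsum_norm x = (Num.sqrt (hsum_rdot x x))%:C.
Proof. by rewrite /hsum_rdot /hsum_inner raddfD. Qed.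

Lemma hsum_normD x y : hsum_norm (x + y) <= hsum_norm x + hsum_norm y.
Proof. by rewrite !hsum_normE -rmorphD lecR (rf_Minkowski hsum_rdot_form). Qed.

Lemma hsum_normZ (k : R[i]) x : hsum_norm (k *: x) = `|k| * hsum_norm x.
Proof.
rewrite /hsum_norm !nrm2Z -mulrDr sqrtrM; last first.
  by case: k => a b /=; rewrite mulrN opprK addr_ge0 // -expr2 sqr_ge0.
by rewrite rmorphM /= normc_def; case: k => a b /=; rewrite mulrN opprK.
Qed.

Lemma hsum_norm0_eq0 x : hsum_norm x = 0 -> x = 0.
Proof.
case: x => x y; rewrite /hsum_norm /= => /complexI/eqP.
rewrite sqrtr_eq0 => le0; have := nrm2_ge0 x; have := nrm2_ge0 y => hy hx.
by congr (_, _); apply: nrm2_eq0; lra.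
Qed.

HB.instance Definition _ := Lmodule_isNormed.Build R[i] hsum
  hsum_normD hsum_normZ hsum_norm0_eq0.

Lemma hsum_complete (F : set_system hsum) :
  ProperFilter F -> cauchy F -> cvg F.
Proof.
move=> FF /cauchy_ballP cF.
have le1 (x : hsum) : `|x.1| <= `|x|.
  by rewrite normr_nrm2 lecR ler_wsqrtr // lerDl nrm2_ge0.
have le2 (x : hsum) : `|x.2| <= `|x|.
  by rewrite normr_nrm2 lecR ler_wsqrtr // lerDr nrm2_ge0.
have c1 : cauchy (fst @ F).
  apply/cauchy_ballP => e e0; rewrite (@near_map2 _ _ _ _ fst fst F F).
  apply: filterS (cF e e0) => -[x y] /=.
  rewrite -!ball_normE /ball_ /=; apply: le_lt_trans.
  exact: (le1 (x - y)).
have c2 : cauchy (snd @ F).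
  apply/cauchy_ballP => e e0; rewrite (@near_map2 _ _ _ _ snd snd F F).
  apply: filterS (cF e e0) => -[x y] /=.
  rewrite -!ball_normE /ball_ /=; apply: le_lt_trans.
  exact: (le2 (x - y)).
have c1l : cvg (fst @ F) by exact: cauchy_cvg.
have [l1 cl1] := (cvg_ex (fst @ F)).1 c1l.
have c2l : cvg (snd @ F) by exact: cauchy_cvg.
have [l2 cl2] := (cvg_ex (snd @ F)).1 c2l.
apply/cvg_ex; exists ((l1, l2) : hsum).
apply/(@cvgrPdist_lt _ hsum) => e e0.
have e20 : 0 < e / 2 by rewrite divr_gt0.
move/cvgrPdist_lt : cl1 => /(_ _ e20) n1.
move/cvgrPdist_lt : cl2 => /(_ _ e20) n2.
near=> x.
have h1 : `|l1 - x.1| < e / 2 by near: x.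
have h2 : `|l2 - x.2| < e / 2 by near: x.
rewrite [e]splitr; apply: le_lt_trans (ltrD h1 h2).
rewrite !normr_nrm2 -rmorphD lecR.
rewrite -(@ler_pXn2r _ 2) ?nnegrE ?addr_ge0 ?sqrtr_ge0 //.
rewrite sqrrD !sqr_sqrtr ?nrm2_ge0 ?addr_ge0 ?nrm2_ge0 //.
rewrite lerD2r lerDl mulrn_wge0 // mulr_ge0 ?sqrtr_ge0 //.
Unshelve. all: by end_near. Qed.

HB.instance Definition _ := Uniform_isComplete.Build hsum hsum_complete.


Lemma hsum_innerDl (u : hsum) : zmod_morphism (hsum_inner^~ u).
Proof.
move=> x y; rewrite /hsum_inner [(x - y).1]/(x.1 - y.1) [(x - y).2]/(x.2 - y.2).
by rewrite !linearBl /= opprD addrACA.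
Qed.

Lemma hsum_innerDr (u : hsum) : zmod_morphism (hsum_inner u).
Proof.
move=> x y; rewrite /hsum_inner [(x - y).1]/(x.1 - y.1) [(x - y).2]/(x.2 - y.2).
by rewrite !linearBr /= opprD addrACA.
Qed.

Lemma hsum_innerZl (u : hsum) : scalable_for *%R (hsum_inner^~ u).
Proof.
move=> k x; rewrite /hsum_inner [(k *: x).1]/(k *: x.1) [(k *: x).2]/(k *: x.2).
by rewrite !innerZl mulrDr.
Qed.

Lemma hsum_innerZr (u : hsum) :
  scalable_for (Num.conj \; *%R) (hsum_inner u).
Proof.
move=> k x; rewrite /hsum_inner [(k *: x).1]/(k *: x.1) [(k *: x).2]/(k *: x.2).
by rewrite !innerZr /= mulrDr.
Qed.

HB.instance Definition _ := isBilinear.Build R[i] hsum hsum R[i]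
  *%R (Num.conj \; *%R) hsum_inner
  hsum_innerDl hsum_innerDr hsum_innerZl hsum_innerZr.

Lemma hsum_innerC x y :
  hsum_inner x y = (-1) ^+ false * Num.conj (hsum_inner y x).
Proof.
by rewrite mul1r /hsum_inner rmorphD /= !(innerC y.1, innerC y.2) !conjCK.
Qed.

HB.instance Definition _ := isHermitianSesquilinear.Build R[i] hsum false
  Num.conj hsum_inner hsum_innerC.

Lemma hsum_innerE x : hsum_inner x x = `|x| ^+ 2.
Proof.
rewrite /hsum_inner !innerxx -rmorphD -rmorphXn /=.
by rewrite sqr_sqrtr // addr_ge0 ?nrm2_ge0.
Qed.

Lemma hsum_inner_gt0 x : x != 0 -> 0 < hsum_inner x x.
Proof. by move=> x0; rewrite hsum_innerE exprn_gt0 // normr_gt0. Qed.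

HB.instance Definition _ := isDotProduct.Build R[i] hsum hsum_inner
  hsum_inner_gt0.

HB.instance Definition _ := CompleteNormedModule_isHilbert.Build R hsum
  hsum_innerE.

End HilbertSum.

Lemma hsumE (R : realType) (H1 H2 : hilbertType R) (x y : hsum H1 H2) :
  inner x y = inner x.1 y.1 + inner x.2 y.2.
Proof. by []. Qed.

(** * Completeness and orthogonal projections *)

Lemma gt0_complexE (R : realType) (e : R[i]) :
  0 < e -> exists2 r : R, 0 < r & e = r%:C.
Proof.
move=> e0; exists (complex.Re e); last by rewrite RRe_real // gtr0_real.
by move: e0; rewrite ltcE => /andP[_].
Qed.

Lemma natinv_lt (R : realType) (e : R) : 0 < e ->
  exists N, forall n, (N <= n)%N -> n.+1%:R^-1 < e.
Proof.
move=> e0; exists (Num.truncn e^-1) => n le_n.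
rewrite invf_plt ?posrE ?ltr0n // (lt_le_trans (truncnS_gt _)) //.
by rewrite ler_nat ltnS.
Qed.

Lemma inf_approx (R : realType) (E : set R) (d : R) :
  (forall r, E r -> d <= r) ->
  (forall e, 0 < e -> exists2 r, E r & r < d + e) -> inf E = d.
Proof.
move=> lb app; have [r0 Er0 _] := app _ ltr01.
apply/eqP; rewrite eq_le; apply/andP; split; last first.
  by apply: lb_le_inf => //; exists r0.
apply/ler_addgt0Pr => e /app[r Er lt_r]; apply: le_trans (ltW lt_r).
by apply: ge_inf => //; exists d.
Qed.

Section Modulus.
Variable R : realType.
Implicit Types z : R[i].

(** The squared modulus, as a real number. *)
Definition sqmod z : R := complex.Re z ^+ 2 + complex.Im z ^+ 2.

Lemma sqmod_ge0 z : 0 <= sqmod z.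
Proof. by rewrite addr_ge0 ?sqr_ge0. Qed.

Lemma sqmod_eq0 z : sqmod z = 0 -> z = 0.
Proof.
case: z => a b; rewrite /sqmod /= => /eqP.
by rewrite paddr_eq0 ?sqr_ge0 // !sqrf_eq0 => /andP[/eqP -> /eqP ->].
Qed.

Lemma sqmodB_le z1 z2 : sqmod (z1 - z2) <= 2 * (sqmod z1 + sqmod z2).
Proof.
case: z1 z2 => [a b] [c d]; rewrite /sqmod /=.
by have := sqr_ge0 (a + c); have := sqr_ge0 (b + d); nra.
Qed.

Lemma normr_lt_sqmod z (e : R) : 0 < e -> (`|z| < e%:C) = (sqmod z < e ^+ 2).
Proof.
move=> e0; rewrite normc_def ltcR.
rewrite -[in LHS](@ltr_pXn2r _ 2) ?nnegrE ?sqrtr_ge0 ?ltW //.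
by rewrite sqr_sqrtr ?sqmod_ge0.
Qed.

End Modulus.

Section Geometry.
Variables (R : realType) (H : hilbertType R).
Implicit Types (x y z : H) (k : R[i]).

Let rdotP := @rdot_form R H.

Lemma normr_lt_nrm2 x (r : R) : 0 < r -> (`|x| < r%:C) = (nrm2 x < r ^+ 2).
Proof.
move=> r0; rewrite normr_nrm2 ltcR.
rewrite -[in LHS](@ltr_pXn2r _ 2) ?nnegrE ?sqrtr_ge0 ?ltW //.
by rewrite sqr_sqrtr ?nrm2_ge0.
Qed.

Lemma hilbert_complete (x : nat -> H) :
  (forall e : R, 0 < e -> exists N, forall n m, (N <= n)%N -> (N <= m)%N ->
     nrm2 (x n - x m) < e) ->
  exists l, forall e : R, 0 < e -> exists N, forall n, (N <= n)%N ->
     nrm2 (l - x n) < e.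
Proof.
move=> cx; have c : cauchy (x @ \oo).
  apply/cauchy_ballP => _ /gt0_complexE[r r0 ->].
  rewrite (@near_map2 _ _ _ _ x x \oo \oo).
  have [N HN] := cx _ (exprn_gt0 2 r0).
  exists ([set n | (N <= n)%N], [set n | (N <= n)%N]) => /=.
    by split; exists N.
  move=> -[n m] /= [le_n le_m]; rewrite -ball_normE /ball_ /= normr_lt_nrm2 //.
  exact: HN.
have [l cl] := (cvg_ex (x @ \oo)).1 (cauchy_cvg _ c).
exists l => e e0.
have s0 : 0 < Num.sqrt e by rewrite sqrtr_gt0.
move/cvgrPdist_lt : cl => /(_ (Num.sqrt e)%:C).
rewrite ltcR => /(_ s0) [N _ HN].
exists N => n le_n; have := HN _ le_n; rewrite /= normr_lt_nrm2 // sqr_sqrtr //.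
exact: ltW.
Qed.

Lemma nrm2_0 : nrm2 (0 : H) = 0.
Proof. by rewrite -(scale0r 0) nrm2Z /= mul0r mul0r subr0 mul0r. Qed.

Lemma nrm2Zr (r : R) x : nrm2 (r%:C *: x) = r ^+ 2 * nrm2 x.
Proof. by rewrite /nrm2 (rfZl rdotP) (rfZr rdotP) mulrA expr2. Qed.

Lemma nrm2N x : nrm2 (- x) = nrm2 x.
Proof. by rewrite /nrm2 (rfNl rdotP) (rfNr rdotP) opprK. Qed.

Lemma nrm2C x y : nrm2 (x - y) = nrm2 (y - x).
Proof. by rewrite -nrm2N opprB. Qed.

Lemma nrm2D_le x y : nrm2 (x + y) <= 2 * (nrm2 x + nrm2 y).
Proof. exact: rf_sqD_le. Qed.

Lemma nrm2D_lt x y (e : R) :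
  nrm2 x < e / 4 -> nrm2 y < e / 4 -> nrm2 (x + y) < e.
Proof. by move=> hx hy; have := nrm2D_le x y; lra. Qed.

(** The weight t replaces the triangle inequality for square roots: t close to 0
    shows that the squared norm varies little under small perturbations. *)
Lemma nrm2D_weighted x y (t : R) : 0 < t ->
  nrm2 (x + y) <= (1 + t) * nrm2 x + (1 + t^-1) * nrm2 y.
Proof.
move=> t0; have := rf_ge0 rdotP (t%:C *: x - y).
rewrite (rf_sqB rdotP) !(rfZl rdotP) (rfZr rdotP) /nrm2 (rf_sqD rdotP) => h.
rewrite -subr_ge0.
have -> : (1 + t) * rdot x x + (1 + t^-1) * rdot y y -
   (rdot x x + 2 * rdot x y + rdot y y) =
   t^-1 * (t * (t * rdot x x) - 2 * (t * rdot x y) + rdot y y).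
  by field; rewrite gt_eqF.
by rewrite mulr_ge0 // invr_ge0 ltW.
Qed.

Lemma nrm2_upper_continuous x (e : R) : 0 < e ->
  exists2 d : R, 0 < d & forall y, nrm2 y < d -> nrm2 (x + y) <= nrm2 x + e.
Proof.
move=> e0; have hx := nrm2_ge0 x; pose t := e / (2 * (nrm2 x + 1)).
have t0 : 0 < t by rewrite divr_gt0 // mulr_gt0 // ltr_wpDl.
have c0 : 0 < 1 + t^-1 by rewrite addr_gt0 ?invr_gt0.
have tE : t * (nrm2 x + 1) = e / 2.
  by rewrite /t; field; rewrite gt_eqF // ltr_wpDl.
exists (e / 2 / (1 + t^-1)) => [|y]; first by rewrite !divr_gt0.
rewrite ltr_pdivlMr // => hy; have := nrm2D_weighted x y t0.
by move: hy; rewrite [nrm2 y * _]mulrC; lra.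
Qed.

Lemma nrm2_le_approx x (d : R) :
  (forall e : R, 0 < e -> exists2 y, nrm2 (x - y) < e & nrm2 y <= d + e) ->
  nrm2 x <= d.
Proof.
move=> app; rewrite leNgt; apply/negP => ltd.
set D := nrm2 x in ltd; have [D0|D0] := ltP 0 D; last first.
  have d0 : 0 < - d / 2 by lra.
  by have [y _] := app _ d0; have := nrm2_ge0 y; lra.
pose t := (D - d) / (2 * D).
have t0 : 0 < t by rewrite divr_gt0 // ?mulr_gt0 //; lra.
pose c := 3 + t + t^-1.
have ti0 : 0 < t^-1 by rewrite invr_gt0.
have c0 : 0 < c by rewrite /c; lra.
have e0 : 0 < (D - d) / (2 * c) by rewrite divr_gt0 // ?mulr_gt0 //; lra.
have [y hxy hy] := app _ e0; set e := (D - d) / (2 * c) in e0 hxy hy.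
have key : D <= (1 + t) * nrm2 y + (1 + t^-1) * nrm2 (x - y).
  by rewrite /D -{1}(subrK y x) addrC; exact: nrm2D_weighted.
have tD : t * D = (D - d) / 2 by rewrite /t; field; rewrite gt_eqF.
have ec : e * c = (D - d) / 2 by rewrite /e; field; rewrite gt_eqF.
have b1 : (1 + t) * nrm2 y <= (1 + t) * (d + e) by rewrite ler_pM2l //; lra.
have b2 : (1 + t^-1) * nrm2 (x - y) <= (1 + t^-1) * e.
  by rewrite ler_pM2l; [exact: ltW | lra].
have td : t * d < t * D by rewrite ltr_pM2l.
move: ec; rewrite /c; nra.
Qed.

Lemma inner0l x : inner (0 : H) x = 0.
Proof. by rewrite linear0l. Qed.

Lemma inner_ext x y : (forall z, inner x z = inner y z) -> x = y.
Proof.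
move=> h; apply/subr0_eq/nrm2_eq0; rewrite /nrm2 /rdot.
by rewrite innerDl h -innerDl subrr inner0l.
Qed.

(** Closedness is stated by approximation in squared norm, so that real
    estimates suffice to check it. *)
Record closed_submodule (M : set H) : Prop := ClosedSubmodule {
  cs0 : M 0;
  csP : forall k x y, M x -> M y -> M (k *: x + y);
  cs_closed : forall x,
    (forall e : R, 0 < e -> exists2 y, M y & nrm2 (x - y) < e) -> M x }.

Definition orthoproj (M : set H) (P : H -> H) : Prop :=
  forall x, M (P x) /\ forall y, M y -> inner (x - P x) y = 0.

Section ClosedRange.
Variables (X : lmodType R[i]) (L : X -> H).
Hypothesis Llin : forall k a b, L (k *: a + b) = k *: L a + L b.

Definition closed_range : set H :=
  [set x | forall e : R, 0 < e -> exists a, nrm2 (x - L a) < e].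

Lemma closed_range_sub a : closed_range (L a).
Proof. by move=> e e0; exists a; rewrite subrr nrm2_0. Qed.

Lemma closed_range_submodule : closed_submodule closed_range.
Proof.
split.
- move=> e e0; exists 0.
  have -> : L 0 = 0.
    by apply: (addrI (L 0)); have := Llin 1 0 0; rewrite !scale1r !addr0.
  by rewrite subrr nrm2_0.
- move=> k x y Mx My e e0; pose c := complex.Re (k * k^*) + 1.
  have k0 : 0 <= complex.Re (k * k^*).
    by case: k {c} => a b /=; rewrite mulrN opprK addr_ge0 // -expr2 sqr_ge0.
  have c0 : 0 < c by rewrite /c ltr_wpDl.
  have e40 : 0 < e / 4 by rewrite divr_gt0.
  have [a ha] := Mx _ (divr_gt0 e40 c0); have [b hb] := My _ e40.
  exists (k *: a + b).
  rewrite Llin opprD addrACA -scalerBr; apply: nrm2D_lt => //.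
  rewrite nrm2Z; rewrite ltr_pdivlMr // in ha.
  by have := nrm2_ge0 (x - L a); rewrite /c in ha; lra.
- move=> x app e e0; have e40 : 0 < e / 4 by rewrite divr_gt0.
  have [y My hy] := app _ e40; have [a ha] := My _ e40; exists a.
  by rewrite -(subrK y x) -addrA; apply: nrm2D_lt.
Qed.

End ClosedRange.

Section Submodule.
Variable M : set H.
Hypothesis MP : closed_submodule M.

Lemma csZ k x : M x -> M (k *: x).
Proof.
by move=> Mx; rewrite -[_ *: _]addr0; apply: (csP MP) => //; exact: cs0.
Qed.

Lemma csD x y : M x -> M y -> M (x + y).
Proof. by move=> Mx My; rewrite -[x]scale1r; exact: (csP MP). Qed.

Lemma csB x y : M x -> M y -> M (x - y).
Proof. by move=> Mx My; rewrite -scaleN1r addrC; exact: (csP MP). Qed.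

(** By the parallelogram identity, a minimizing sequence for the distance is a
    Cauchy sequence, because midpoints stay in M. *)
Lemma nearest_point x :
  exists2 p, M p & forall y, M y -> nrm2 (x - p) <= nrm2 (x - y).
Proof.
pose E := [set r | exists2 y, M y & r = nrm2 (x - y)].
have E0 : E !=set0 by exists (nrm2 (x - 0)); exists 0 => //; exact: cs0.
have Elb : lbound E 0 by move=> _ [y _ ->]; exact: nrm2_ge0.
have Einf : has_inf E by split=> //; exists 0.
pose d := inf E.
have dle y : M y -> d <= nrm2 (x - y).
  by move=> My; apply: ge_inf; [exists 0 | exists y].
have /choice[y_ y_P] : forall n, exists y, M y /\ nrm2 (x - y) < d + n.+1%:R^-1.
  move=> n; have n0 : 0 < n.+1%:R^-1 :> R by rewrite invr_gt0 ltr0n.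
  by have [_ [y My ->] lty] := inf_adherent n0 Einf; exists y.
(* parallelogram identity; d bounds the distance to the midpoint m *)
have par y z : M y -> M z ->
    nrm2 (y - z) <= 2 * nrm2 (x - y) + 2 * nrm2 (x - z) - 4 * d.
  move=> My Mz; pose m := (2^-1)%:C *: (y + z).
  have Mm : M m by exact/csZ/csD.
  have dm := dle _ Mm.
  have E1 : nrm2 (y - z) = nrm2 ((x - y) - (x - z)).
    by rewrite opprB [in RHS]addrC addrA subrK nrm2C.
  have E2 : (x - y) + (x - z) = 2%:C *: (x - m).
    rewrite scalerBr /m scalerA -rmorphM mulfV ?pnatr_eq0 // rmorph1 scale1r.
    by rewrite rmorphMn rmorph1 mulr2n scalerDl scale1r opprD addrACA.
  have := rf_sqD rdotP (x - y) (x - z); have := rf_sqB rdotP (x - y) (x - z).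
  rewrite E2 -!/(nrm2 _) nrm2Zr -E1.
  by lra.
have [|p Hp] := @hilbert_complete y_.
  move=> e e0; have e40 : 0 < e / 4 by rewrite divr_gt0.
  have [N HN] := natinv_lt e40; exists N => n m le_n le_m.
  have := par _ _ (y_P n).1 (y_P m).1.
  have := (y_P n).2; have := (y_P m).2; have := HN _ le_n; have := HN _ le_m.
  by move: m.+1%:R^-1 n.+1%:R^-1 => a b; lra.
exists p.
  apply: (cs_closed MP) => e e0; have [N HN] := Hp _ e0.
  by exists (y_ N); [exact: (y_P N).1 | exact: HN].
move=> y My; apply: le_trans (dle _ My).
apply: nrm2_le_approx => e e0.
have [N1 HN1] := Hp _ e0; have [N2 HN2] := natinv_lt e0.
pose n := maxn N1 N2; exists (x - y_ n).
  by rewrite opprB addrC addrA subrK nrm2C HN1 // leq_maxl.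
have := (y_P n).2; have := HN2 n (leq_maxr _ _).
by move: n.+1%:R^-1 => a; lra.
Qed.

(** The residual of a nearest point is orthogonal to M: the perturbation by
    (b / h) y, with b the real inner product, would otherwise come closer. *)
Lemma orthoproj_exists : exists P, orthoproj M P.
Proof.
suff /choice[P PP] : forall x, exists p,
    M p /\ forall y, M y -> inner (x - p) y = 0 by exists P.
move=> x; have [p Mp minp] := nearest_point x; exists p; split=> //.
have rorth y : M y -> rdot (x - p) y = 0.
  move=> My; set b := rdot (x - p) y; pose h := nrm2 y + 1.
  have h0 : 0 < h by have := nrm2_ge0 y; rewrite /h; lra.
  have := minp (p + (b / h)%:C *: y) (csD Mp (csZ _ My)).
  rewrite opprD addrA {2}/nrm2 (rf_sqB rdotP) !(rfZl rdotP) (rfZr rdotP).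
  rewrite -/(nrm2 _) -/(nrm2 y) (rfZr rdotP) -/b => le.
  have : 2 * (b / h * b) <= b / h * (b / h * nrm2 y) by lra.
  have -> : nrm2 y = h - 1 by rewrite /h addrK.
  have -> : b / h * (b / h * (h - 1)) = b / h * b - (b / h) ^+ 2.
    by field; rewrite gt_eqF.
  have -> : b / h * b = h * (b / h) ^+ 2 by field; rewrite gt_eqF.
  move=> le2; have s0 := sqr_ge0 (b / h).
  have : (b / h) ^+ 2 = 0 by nra.
  by move/eqP; rewrite sqrf_eq0 mulf_eq0 invr_eq0 (gt_eqF h0) orbF => /eqP.
by move=> y My; apply: inner_eq0P; apply: rorth => //; exact: csZ.
Qed.

Variable P : H -> H.
Hypothesis PP : orthoproj M P.

Lemma orthoproj_uniq x p :
  M p -> (forall y, M y -> inner (x - p) y = 0) -> P x = p.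
Proof.
move=> Mp op; have [MPx oPx] := PP x; apply/subr0_eq/nrm2_eq0.
have Mz := csB MPx Mp; set z := P x - p in Mz *.
have -> : nrm2 z = complex.Re (inner ((x - p) - (x - P x)) z).
  by congr (complex.Re (inner _ z)); rewrite opprB addrC addrA subrK.
by rewrite innerDl op // -scaleN1r innerZl oPx // mulr0 addr0.
Qed.

Lemma orthoproj_id x : M x -> P x = x.
Proof.
move=> Mx; apply: orthoproj_uniq => // y _.
by rewrite subrr inner0l.
Qed.

Lemma orthoproj_in x : M (P x).
Proof. by have [] := PP x. Qed.

Lemma orthoproj_orth x y : M y -> inner (x - P x) y = 0.
Proof. by have [_] := PP x; apply. Qed.

Lemma orthoproj_sym x y : inner (P x) y = inner x (P y).
Proof.
have e1 : inner (P x) y = inner (P x) (P y).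
  rewrite -[in LHS](subrK (P y) y) innerDr (innerC _ (y - P y)).
  by rewrite orthoproj_orth ?rmorph0 ?add0r //; exact: orthoproj_in.
rewrite e1 -[in RHS](subrK (P x) x) innerDl orthoproj_orth ?add0r //.
exact: orthoproj_in.
Qed.

Lemma orthoproj_idem x : P (P x) = P x.
Proof. exact/orthoproj_id/orthoproj_in. Qed.

Lemma orthoproj_pythagoras x : nrm2 x = nrm2 (P x) + nrm2 (x - P x).
Proof.
rewrite -{1}(subrK (P x) x) /nrm2 (rf_sqD rdotP) {2}/rdot.
rewrite orthoproj_orth; last exact: orthoproj_in.
by rewrite mulr0 addr0 addrC.
Qed.

(** A projection commutes with B as soon as B and its adjoint preserve M. *)
Lemma orthoproj_comm (B B' : H -> H) :
  (forall x y, B (x - y) = B x - B y) ->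
  (forall x y, inner (B x) y = inner x (B' y)) ->
  (forall x, M x -> M (B x)) -> (forall x, M x -> M (B' x)) ->
  forall x, P (B x) = B (P x).
Proof.
move=> Blin adj MB MB' x; apply: orthoproj_uniq; first exact/MB/orthoproj_in.
by move=> y My; rewrite -Blin adj orthoproj_orth //; exact: MB'.
Qed.

End Submodule.
End Geometry.

(** * Symmetric operators *)

Lemma convex_bounded_nonincr (R : realType) (m : nat -> R) (B : R) :
  (forall k, 2 * m k.+1 <= m k + m k.+2) -> (forall k, m k <= B) ->
  m 1%N <= m 0%N.
Proof.
move=> cvx bnd; rewrite leNgt; apply/negP => lt01.
have step k : m 1%N - m 0%N <= m k.+1 - m k.
  by elim: k => // k IH; have := cvx k; lra.
have lin k : k%:R * (m 1%N - m 0%N) <= m k - m 0%N.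
  elim: k => [|k IH]; first by rewrite mul0r subrr.
  by have := step k; rewrite -natr1 mulrDl mul1r; lra.
have d0 : 0 < m 1%N - m 0%N by rewrite subr_gt0.
pose k := (Num.truncn ((B - m 0%N) / (m 1%N - m 0%N))).+1.
have := truncnS_gt ((B - m 0%N) / (m 1%N - m 0%N)); rewrite -/k ltr_pdivrMr //.
by have := lin k; have := bnd k; lra.
Qed.

Section Operators.
Variables (R : realType) (H : hilbertType R).
Implicit Types (x y z : H) (k : R[i]) (T S V : H -> H).

Let rdotP := @rdot_form R H.

(** Symmetry implies linearity because the inner product separates points, so
    operators are plain maps. *)
Definition symop T : Prop := forall x y, inner (T x) y = inner x (T y).

Section SymOp.
Variable T : H -> H.
Hypothesis Tsym : symop T.

Lemma symop_lin k x y : T (k *: x + y) = k *: T x + T y.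
Proof.
apply: inner_ext => z.
by rewrite Tsym !innerDl !innerZl !Tsym.
Qed.

Lemma symopD x y : T (x + y) = T x + T y.
Proof. by rewrite -[x]scale1r symop_lin !scale1r. Qed.

Lemma symopB x y : T (x - y) = T x - T y.
Proof. by rewrite -scaleN1r addrC symop_lin scaleN1r addrC. Qed.

Lemma symop0 : T 0 = 0.
Proof. by have := symopB 0 0; rewrite !subrr. Qed.

Lemma symopZ k x : T (k *: x) = k *: T x.
Proof. by rewrite -[_ *: x]addr0 symop_lin symop0 addr0.
Qed.

Lemma symop_rdot x y : rdot (T x) y = rdot x (T y).
Proof. by rewrite /rdot Tsym. Qed.

Lemma symop_real x : inner (T x) x = (rdot (T x) x)%:C.
Proof.
rewrite inner_rdot; congr (Complex _ _).
have := Tsym x x; rewrite (innerC x) inner_rdot => -[].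
by lra.
Qed.

Hypothesis Tpos : forall x, 0 <= rdot (T x) x.

Lemma symop_form : real_form (fun x y => rdot (T x) y).
Proof.
split=> [x y z|k x y|x y|x] //.
- by rewrite symopD (rfDl rdotP).
- by rewrite symopZ (rfZl rdotP).
- by rewrite symop_rdot (rfC rdotP).
Qed.

(** Cauchy-Schwarz for the form of T, applied to x and T x. *)
Lemma symop_nrm2_le (c : R) : (forall x, rdot (T x) x <= c * nrm2 x) ->
  forall x, nrm2 (T x) <= c * rdot (T x) x.
Proof.
move=> le_c x; have := rf_CauchySchwarz symop_form x (T x).
rewrite -/(nrm2 (T x)) => cs.
have h0 := nrm2_ge0 (T x); have [hpos|hle] := ltP 0 (nrm2 (T x)); last first.
  have -> : nrm2 (T x) = 0 by lra.
  have [cneg|cpos] := ltP c 0; last exact: mulr_ge0.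
  have := le_c x; have := nrm2_ge0 x; have := Tpos x => a b d.
  have : c * nrm2 x <= 0 by rewrite mulr_le0_ge0 // ltW.
  move=> e; have {}e : rdot (T x) x = 0 by lra.
  by rewrite e mulr0.
rewrite -(ler_pM2r hpos) -expr2 (le_trans cs) //.
by rewrite [leRHS]mulrAC mulrC ler_wpM2r.
Qed.

End SymOp.

Lemma symop_sqmod_le T : symop T -> (forall x, 0 <= rdot (T x) x <= nrm2 x) ->
  forall x z, sqmod (inner (T x) z) <= 2 * nrm2 z * rdot (T x) x.
Proof.
move=> Tsym T01 x z.
have Tform : real_form (fun x y => rdot (T x) y).
  by apply: symop_form => // y; have /andP[] := T01 y.
have cs y : rdot (T x) y ^+ 2 <= nrm2 y * rdot (T x) x.
  apply: le_trans (rf_CauchySchwarz Tform _ _) _.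
  by rewrite mulrC ler_wpM2r ?(rf_ge0 Tform) //; have /andP[] := T01 y.
have := cs z; have := cs ('i *: z).
have -> : nrm2 ('i *: z) = nrm2 z.
  by rewrite nrm2Z /= mul0r mul1r opprK add0r mul1r.
by rewrite inner_rdot /sqmod /=; lra.
Qed.

Lemma inner_sqmod_le x y : sqmod (inner x y) <= 2 * nrm2 y * nrm2 x.
Proof.
by apply: (@symop_sqmod_le id) => // z; rewrite -/(nrm2 z) nrm2_ge0 lexx.
Qed.

(** The sequence of the values of the form of T at V^n x is convex, as
    (T V^(n+1) x, V^(n+1) x) = (T V^n x, V^(n+2) x), and it is bounded; hence it
    is nonincreasing.  This avoids square roots of operators. *)
Lemma symop_comm_le T V : symop T -> symop V ->
  (forall x, 0 <= rdot (T x) x <= nrm2 x) -> (forall x, nrm2 (V x) <= nrm2 x) ->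
  (forall x, T (V x) = V (T x)) ->
  forall x, rdot (T (V x)) (V x) <= rdot (T x) x.
Proof.
move=> Tsym Vsym T01 V1 TV x.
have Tform : real_form (fun y z => rdot (T y) z).
  by apply: symop_form => // y; have /andP[] := T01 y.
pose v n := iter n V x.
apply: (@convex_bounded_nonincr _ (fun n => rdot (T (v n)) (v n)) (nrm2 x)).
  move=> n; have := rf_ge0 Tform (v n - v n.+2); rewrite (rf_sqB Tform).
  have -> : rdot (T (v n.+1)) (v n.+1) = rdot (T (v n)) (v n.+2).
    by rewrite -[v n.+1]/(V (v n)) TV (symop_rdot Vsym).
  by lra.
elim=> [|n IH]; first by have /andP[] := T01 x.
have /andP[_ h] := T01 (v n.+1); apply: le_trans h _.
elim: n {IH} => [|n IH]; first exact: V1.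
exact: le_trans (V1 _) IH.
Qed.

(** A coercive operator has a closed range, and the orthogonal complement of
    the range is its kernel, which is trivial. *)
Lemma symop_inverse S (c d : R) : symop S -> 0 < d ->
  (forall x, d * nrm2 x <= rdot (S x) x) ->
  (forall x, rdot (S x) x <= c * nrm2 x) ->
  exists S', symop S' /\ forall x, S (S' x) = x /\ S' (S x) = x.
Proof.
move=> Ssym d0 dS Sc.
have Spos x : 0 <= rdot (S x) x.
  by apply: le_trans (dS x); rewrite mulr_ge0 ?nrm2_ge0 // ltW.
have low x : d ^+ 2 * nrm2 x <= nrm2 (S x).
  have cs := rf_CauchySchwarz rdotP (S x) x; rewrite -!/(nrm2 _) in cs.
  have hx := nrm2_ge0 x; have := dS x; have := nrm2_ge0 (S x).
  have [hpos|hle] := ltP 0 (nrm2 x); last first.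
    have -> : nrm2 x = 0 by lra.
    by rewrite !mulr0.
  move=> _ le_d; rewrite -(ler_pM2r hpos); apply: le_trans cs.
  have -> : d ^+ 2 * nrm2 x * nrm2 x = (d * nrm2 x) ^+ 2 by ring.
  by rewrite ler_pXn2r // nnegrE ?mulr_ge0 // ltW.
have c0 : forall x, nrm2 (S x) <= c ^+ 2 * nrm2 x.
  move=> x; have h1 := symop_nrm2_le Ssym Spos Sc x.
  have [cneg|cpos] := ltP c 0.
    have : c * rdot (S x) x <= 0 by rewrite mulr_le0_ge0 // ltW.
    move=> h2; apply: le_trans h1 (le_trans h2 _).
    by rewrite mulr_ge0 ?sqr_ge0 ?nrm2_ge0.
  by apply: le_trans h1 _; rewrite expr2 -mulrA ler_wpM2l.
have inj x y : S x = S y -> x = y.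
  move=> e; apply/subr0_eq/nrm2_eq0.
  have := low (x - y); rewrite (symopB Ssym) e subrr nrm2_0 => h.
  have := nrm2_ge0 (x - y); have : 0 < d ^+ 2 by rewrite exprn_gt0.
  by move=> d20 h2; apply/eqP; rewrite eq_le h2 andbT -(pmulr_rle0 _ d20).
have d20 : 0 < d ^+ 2 by rewrite exprn_gt0.
have ranC : closed_submodule (range S).
  split=> [|k _ _ [x _ <-] [y _ <-]|z app].
  - by exists 0 => //; exact: symop0.
  - by exists (k *: x + y) => //; rewrite (symop_lin Ssym).
  have /choice[x_ xP] : forall n, exists x, nrm2 (z - S x) < n.+1%:R^-1.
    move=> n; have n0 : 0 < n.+1%:R^-1 :> R by rewrite invr_gt0 ltr0n.
    by have [_ [x _ <-] hx] := app _ n0; exists x.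
  have [|l lP] := @hilbert_complete R H x_.
    move=> e e0; have e1 : 0 < d ^+ 2 * e / 4 by rewrite divr_gt0 ?mulr_gt0.
    have [N HN] := natinv_lt e1; exists N => n m le_n le_m.
    rewrite -(ltr_pM2l d20) (le_lt_trans (low _)) // (symopB Ssym).
    have -> : S (x_ n) - S (x_ m) = (S (x_ n) - z) + (z - S (x_ m)).
      by rewrite addrA subrK.
    apply: nrm2D_lt; first by rewrite nrm2C (lt_trans (xP n)) ?HN.
    by rewrite (lt_trans (xP m)) ?HN.
  exists l => //; apply/esym/subr0_eq/nrm2_eq0/eqP.
  rewrite eq_le nrm2_ge0 andbT; apply/ler_addgt0Pl => e e0; rewrite addr0.
  have e40 : 0 < e / 4 by rewrite divr_gt0.
  have c10 : 0 < c ^+ 2 + 1 by have := sqr_ge0 c; lra.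
  have [N1 HN1] := natinv_lt e40.
  have [N2 HN2] := lP _ (divr_gt0 e40 c10).
  pose n := maxn N1 N2.
  have -> : z - S l = (z - S (x_ n)) + (S (x_ n) - S l) by rewrite addrA subrK.
  apply/ltW/nrm2D_lt; first by rewrite (lt_trans (xP n)) // HN1 // leq_maxl.
  rewrite nrm2C -(symopB Ssym) (le_lt_trans (c0 _)) //.
  have := HN2 n (leq_maxr _ _); rewrite ltr_pdivlMr // => h.
  by have := nrm2_ge0 (l - x_ n); nra.
have [P PP] := orthoproj_exists ranC.
have surj z : exists x, S x = z.
  have [x _ Sx] := orthoproj_in PP z; exists x; rewrite Sx.
  apply/esym/subr0_eq/inj; rewrite (symop0 Ssym).
  apply: inner_ext => y; rewrite inner0l Ssym (orthoproj_orth PP) //.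
have [S' S'P] := choice surj.
have S'S x : S' (S x) = x by apply: inj; rewrite S'P.
exists S'; split=> // x y.
by rewrite -{2}(S'P x) Ssym S'P.
Qed.

End Operators.

(** * The iteration on operators *)

Section Iteration.
Variables (R : realType) (H : hilbertType R).
Variables (W : H -> H) (G : set H).
Implicit Types (x y z : H) (T : H -> H).

Let rdotP := @rdot_form R H.

Hypothesis Wsym : symop W.
Hypothesis W01 : forall x, 0 <= rdot (W x) x <= nrm2 x.
Hypothesis WG : forall x, G (W x).

Let V x := x - W x.

Definition energy T x : R := rdot (T x) x + rdot (V x) x.

(** The invariants of the iteration.  Commutation with everything that commutes
    with W serves both for W itself and for the operators of the representation;
    coercivity makes the next step possible. *)
Record admissible T : Prop := Admissible {
  adm_sym : symop T;
  adm01 : forall x, 0 <= rdot (T x) x <= nrm2 x;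
  admC : forall B : H -> H, (forall x y, B (x - y) = B x - B y) ->
    (forall x, B (W x) = W (B x)) -> forall x, B (T x) = T (B x);
  admG : forall x, G (T x);
  adm_fix : forall x, W x = x -> T x = x;
  adm_coercive : exists2 d : R, 0 < d <= 1 &
    forall x, d * nrm2 x <= energy T x }.

(** T' is T minus the parallel sum of T and V: the sum of energies on the left
    is minimal at d = c, with value (T y, y) - (T' y, y).  That c lies in G is
    what allows d to range over a dense subset of G only. *)
Definition parallel_step T T' : Prop := forall y, exists2 c, G c &
  forall d, rdot (T (y - d)) (y - d) + rdot (V d) d =
    rdot (T y) y - rdot (T' y) y + energy T (d - c).

Lemma V_rdot x y : rdot (V x) y = rdot x y - rdot (W x) y.
Proof. by rewrite /V (rfDl rdotP) (rfNl rdotP). Qed.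

Lemma V_sym : symop V.
Proof.
move=> x y; rewrite /V innerDl innerDr; congr (_ + _).
by rewrite innerNl innerNr Wsym.
Qed.

Lemma V01 x : 0 <= rdot (V x) x <= nrm2 x.
Proof.
have /andP[W0 W1] := W01 x.
by rewrite V_rdot subr_ge0 W1 gerBl W0.
Qed.

Lemma admissible0 : admissible W.
Proof.
split=> //; exists 1; first by rewrite ltr01 lexx.
by move=> x; rewrite mul1r /energy V_rdot addrC subrK.
Qed.

(** With S = T + V and Q = S^-1, completing the square in d gives the minimizer
    c = Q T y and T' = T Q T.  The new coercivity constant d^2 / 2 comes from
    (T' x, x) >= |T x|^2 / 2 and 2 d (T x, x) <= d^2 |x|^2 + |T x|^2. *)
Lemma admissible_step T : admissible T ->
  exists T', admissible T' /\ parallel_step T T'.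
Proof.
move=> [Tsym T01 TC TG Tfix [d /andP[d0 d1] Td]].
have TW x : T (W x) = W (T x) by rewrite (TC W) //; exact: symopB.
pose S x := T x + V x.
have Sx x y : rdot (S x) y = rdot (T x) y + rdot (V x) y.
  by rewrite /S (rfDl rdotP).
have Ssym : symop S.
  by move=> x y; rewrite /S innerDl innerDr Tsym V_sym.
have S2 x : rdot (S x) x <= 2 * nrm2 x.
  by rewrite Sx; have /andP[_] := T01 x; have /andP[_] := V01 x; lra.
have Sd x : d * nrm2 x <= rdot (S x) x by rewrite Sx; exact: Td.
have Spos x : 0 <= rdot (S x) x.
  by apply: le_trans (Sd x); rewrite mulr_ge0 ?nrm2_ge0 // ltW.
have [Q [Qsym QS]] := symop_inverse Ssym d0 Sd S2.
have SQ x : S (Q x) = x by have [] := QS x.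
have {}QS x : Q (S x) = x by have [] := QS x.
have SE x : S x = x - (W x - T x) by rewrite /S /V addrC opprB addrA addrAC.
have QC (B : H -> H) : (forall x y, B (x - y) = B x - B y) ->
    (forall x, B (W x) = W (B x)) -> forall x, B (Q x) = Q (B x).
  move=> BB BW x; rewrite -{2}(SQ x) -[LHS]QS; congr Q.
  by rewrite !SE !BB BW (TC B).
have QT x : Q (T x) = T (Q x).
  by apply/esym/QC => {}x; [exact: symopB | rewrite TW].
pose T' x := T (Q (T x)).
have T'E x : rdot (T' x) x = rdot (S (Q (T x))) (Q (T x)).
  by rewrite SQ /T' (symop_rdot Tsym) (rfC rdotP).
have Sform := symop_form Ssym Spos.
have Tform : real_form (fun x y => rdot (T x) y).
  by apply: symop_form => // x; have /andP[] := T01 x.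
have st : parallel_step T T'.
  move=> y; exists (Q (T y)); first by rewrite QT.
  move=> e; rewrite T'E /energy -Sx (rf_sqB Tform) (rf_sqB Sform).
  have := Sx e e.
  have -> : rdot (S e) (Q (T y)) = rdot (T y) e.
    by rewrite (symop_rdot Ssym) SQ (rfC rdotP).
  by lra.
exists T'; split=> //.
have T'0 x : 0 <= rdot (T' x) x by rewrite T'E.
have T'T x : rdot (T' x) x <= rdot (T x) x.
  have [c _ h] := st x; have := h c.
  rewrite subrr /energy -Sx (symop0 Ssym) -/(nrm2 0) nrm2_0 addr0 => e.
  rewrite -subr_ge0 -e addr_ge0 //; first by have /andP[] := T01 (x - c).
  by have /andP[] := V01 c.
split.
- by move=> x y; rewrite /T' Tsym Qsym Tsym.
- move=> x; rewrite T'0 (le_trans (T'T x)) //.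
  by have /andP[] := T01 x.
- by move=> B BB BW x; rewrite /T' (TC B) // (QC B) // (TC B).
- by move=> x; exact: TG.
- move=> x Wx; rewrite /T' !(Tfix _ Wx).
  have {1}-> : x = S x by rewrite /S /V (Tfix _ Wx) Wx subrr addr0.
  by rewrite QS Tfix.
exists (d ^+ 2 / 2).
  by rewrite divr_gt0 ?exprn_gt0 //= ler_pdivrMr // mul1r; nra.
move=> x; rewrite /energy T'E.
have b1 : nrm2 (T x) <= 2 * rdot (S (Q (T x))) (Q (T x)).
  by rewrite -{1}(SQ (T x)); exact: symop_nrm2_le.
have b2 := Td x; rewrite /energy in b2.
have b3 := rf_ge0 rdotP (d%:C *: x - T x).
rewrite (rf_sqB rdotP) !(rfZl rdotP) (rfZr rdotP) in b3.
rewrite -/(nrm2 x) -/(nrm2 (T x)) in b3.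
rewrite (rfC rdotP x (T x)) in b3.
have /andP[v0 _] := V01 x.
have b4 : d * rdot (V x) x <= rdot (V x) x by rewrite ler_piMl.
nra.
Qed.

Lemma admissible_seq : exists T_ : nat -> H -> H,
  [/\ T_ 0%N = W, forall n, admissible (T_ n) &
      forall n, parallel_step (T_ n) (T_ n.+1)].
Proof.
have /choice[F FP] : forall T, exists T', admissible T ->
    admissible T' /\ parallel_step T T'.
  move=> T; have [aT|naT] := pselect (admissible T); last by exists T.
  by have [T' T'P] := admissible_step aT; exists T'.
pose T_ n := iter n F W.
have adm n : admissible (T_ n).
  by elim: n => [|n /FP[]//]; exact: admissible0.
by exists T_; split=> // n; have [] := FP _ (adm n).
Qed.

Section Step.
Variables T T' : H -> H.
Hypotheses (aT : admissible T) (TT' : parallel_step T T').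

Lemma admissible_form : real_form (fun x y => rdot (T x) y).
Proof.
apply: symop_form; first exact: adm_sym aT.
by move=> x; have /andP[] := adm01 aT x.
Qed.

Lemma V_nrm2_le x : nrm2 (V x) <= rdot (V x) x.
Proof.
rewrite -[leRHS]mul1r; apply: (symop_nrm2_le V_sym) => y.
  by have /andP[] := V01 y.
by rewrite mul1r; have /andP[] := V01 y.
Qed.

(** The drop (T y, y) - (T' y, y) is the energy of the splitting
    y = (y - c) + c, and T (V _) (V _) is bounded by (T (y - c), y - c) on the
    first summand (symop_comm_le) and by (V c, c) on the second. *)
Lemma parallel_step_drop y :
  rdot (T (V y)) (V y) <= 2 * (rdot (T y) y - rdot (T' y) y).
Proof.
have [c _ /(_ c)] := TT' y.
have E0 : energy T (c - c) = 0.
  rewrite subrr /energy (symop0 (adm_sym aT)) (symop0 V_sym).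
  by rewrite -/(nrm2 0) nrm2_0 addr0.
rewrite E0 addr0 => <-.
have -> : V y = V (y - c) + V c by rewrite (symopB V_sym) subrK.
apply: le_trans (rf_sqD_le admissible_form _ _) _.
rewrite ler_pM2l // lerD //.
  apply: (symop_comm_le (adm_sym aT) V_sym (adm01 aT)) => x.
    by apply: le_trans (V_nrm2_le x) _; have /andP[] := V01 x.
  by rewrite /V (symopB (adm_sym aT)) (admC aT (B := W) (symopB Wsym)).
by apply: le_trans (V_nrm2_le c); have /andP[] := adm01 aT (V c).
Qed.

Lemma parallel_step_le y : rdot (T' y) y <= rdot (T y) y.
Proof.
have := rf_ge0 admissible_form (V y); have := parallel_step_drop y; lra.
Qed.

End Step.

Lemma fixed_submodule : closed_submodule [set x | W x = x].
Proof.
split=> [|k x y /= Wx Wy|x app /=].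
- exact: symop0.
- by rewrite (symop_lin Wsym) Wx Wy.
apply/subr0_eq/nrm2_eq0/eqP; rewrite eq_le nrm2_ge0 andbT.
apply/ler_addgt0Pl => e e0; rewrite addr0.
have e40 : 0 < e / 4 by rewrite divr_gt0.
have [y Wy xy] := app _ e40.
have -> : W x - x = W (x - y) + (y - x).
  by rewrite (symopB Wsym) Wy addrA subrK.
apply/ltW/nrm2D_lt; last by rewrite nrm2C.
apply: le_lt_trans xy; rewrite -[leRHS]mul1r.
have W0 z : 0 <= rdot (W z) z by have /andP[] := W01 z.
apply: (@le_trans _ _ (1 * rdot (W (x - y)) (x - y))).
  by apply: symop_nrm2_le => // z; rewrite mul1r; have /andP[] := W01 z.
by rewrite !mul1r; have /andP[] := W01 (x - y).
Qed.

(** The residual of z on the closed range of V is killed by V, hence fixed by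
    W, hence orthogonal to z by hypothesis; being orthogonal to its projection
    as well, it is orthogonal to itself. *)
Lemma orth_fixed_closed_range z : (forall x, W x = x -> inner z x = 0) ->
  closed_range V z.
Proof.
move=> oz; have MP := closed_range_submodule (symop_lin V_sym).
have [P PP] := orthoproj_exists MP.
suff -> : z = P z by exact: (orthoproj_in PP).
have V0 : V (z - P z) = 0.
  apply: inner_ext => y; rewrite V_sym inner0l (orthoproj_orth PP) //.
  exact: closed_range_sub.
have /esym W0 := subr0_eq V0.
apply/subr0_eq/nrm2_eq0; rewrite /nrm2 /rdot {1}innerDl oz // add0r.
rewrite innerNl innerC (orthoproj_orth PP) ?rmorph0 ?oppr0 //.
exact: (orthoproj_in PP).
Qed.

Variable T_ : nat -> H -> H.
Hypotheses (T_adm : forall n, admissible (T_ n))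
           (T_step : forall n, parallel_step (T_ n) (T_ n.+1)).

Lemma small_drop (a : nat -> R) (e : R) : (forall n, 0 <= a n) -> 0 < e ->
  exists n, a n - a n.+1 < e.
Proof.
move=> a0 e0; apply: contrapT => /forallNP h.
have lin n : n%:R * e <= a 0%N - a n.
  elim: n => [|n IH]; first by rewrite mul0r subrr.
  have /negP := h n; rewrite -leNgt -natr1 mulrDl mul1r; lra.
have := lin (Num.truncn (a 0%N / e)).+1; have := truncnS_gt (a 0%N / e).
rewrite ltr_pdivrMr //; have := a0 (Num.truncn (a 0%N / e)).+1; lra.
Qed.

Lemma iterate_nonincr x n m : (n <= m)%N ->
  rdot (T_ m x) x <= rdot (T_ n x) x.
Proof.
move=> /subnK <-; elim: (m - n)%N => // k; apply: le_trans.
exact: parallel_step_le.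
Qed.

(** One index with a small drop at y is enough, z being close to V y. *)
Lemma iterate_orth_small z (e : R) : (forall x, W x = x -> inner z x = 0) ->
  0 < e -> exists n, rdot (T_ n z) z < e.
Proof.
move=> oz e0; have e80 : 0 < e / 8 by rewrite divr_gt0.
have [y hy] := orth_fixed_closed_range oz e80.
have [||n hn8] := @small_drop (fun n => rdot (T_ n y) y) (e / 16).
- by move=> n; exact: (rf_ge0 (admissible_form (T_adm n))).
- by rewrite divr_gt0.
exists n; have h1 := parallel_step_drop (T_adm n) (T_step n) y.
have h2 := rf_sqD_le (admissible_form (T_adm n)) (z - V y) (V y).
rewrite subrK in h2.
have /andP[_ h3] := adm01 (T_adm n) (z - V y).
lra.
Qed.

Variable P : H -> H.
Hypothesis PP : orthoproj [set x | W x = x] P.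

Lemma iterate_split n x :
  rdot (T_ n x) x = nrm2 (P x) + rdot (T_ n (x - P x)) (x - P x).
Proof.
set z := x - P x.
have TP : T_ n (P x) = P x.
  by apply: (adm_fix (T_adm n)); exact: (orthoproj_in PP).
have zP : rdot z (P x) = 0.
  by rewrite /rdot (orthoproj_orth PP) //; exact: (orthoproj_in PP).
have xE : x = P x + z by rewrite addrC subrK.
rewrite [in LHS]xE (rf_sqD (admissible_form (T_adm n))) TP.
by rewrite (rfC rdotP) zP mulr0 addr0.
Qed.

Lemma iterate_lower n x : nrm2 (P x) <= rdot (T_ n x) x.
Proof.
by rewrite iterate_split lerDl; exact: (rf_ge0 (admissible_form (T_adm n))).
Qed.

Lemma iterate_limit x (e : R) : 0 < e -> exists N, forall n, (N <= n)%N ->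
  rdot (T_ n x) x < nrm2 (P x) + e.
Proof.
move=> e0; have oz y : W y = y -> inner (x - P x) y = 0.
  by move=> Wy; exact: (orthoproj_orth PP).
have [N HN] := iterate_orth_small oz e0; exists N => n le_n.
rewrite iterate_split ltrD2l.
exact: le_lt_trans (iterate_nonincr _ le_n) HN.
Qed.

End Iteration.

(** * Representations and parallel sums *)

Section BoundedOperators.
Variables (R : realType) (H : hilbertType R).

Lemma bounded_operator_nrm2 (T : {linear H -> H}) : bounded_operator T <->
  exists2 r : R, 0 <= r & forall x, nrm2 (T x) <= r * nrm2 x.
Proof.
split=> [[M MP]|[r r0 rP]].
  exists (complex.Re `|M| ^+ 2); first exact: sqr_ge0.
  have EM : (complex.Re `|M|)%:C = `|M| by rewrite RRe_real // normr_real.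
  move=> x; rewrite -lecR rmorphM rmorphXn /= EM !nrm2_norm -exprMn.
  rewrite ler_pXn2r ?nnegrE ?mulr_ge0 //; apply: le_trans (MP x) _.
  have M0 : 0 <= M * `|x| by apply: le_trans (MP x).
  by rewrite -(ger0_norm M0) normrM normr_id.
exists (Num.sqrt r)%:C => x.
rewrite -(@ler_pXn2r _ 2) ?nnegrE ?mulr_ge0 ?ler0c ?sqrtr_ge0 //.
by rewrite exprMn -!nrm2_norm -rmorphXn -rmorphM lecR /= sqr_sqrtr.
Qed.

End BoundedOperators.

Section HsumMap.
Variables (R : realType) (H1 H2 : hilbertType R).
Variables (f : {linear H1 -> H1}) (g : {linear H2 -> H2}).

Definition hsum_map (x : hsum H1 H2) : hsum H1 H2 := (f x.1, g x.2).

Lemma hsum_map_linear : linear hsum_map.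
Proof. by move=> k x y; rewrite /hsum_map /= !linearP. Qed.

HB.instance Definition _ := GRing.isLinear.Build R[i] (hsum H1 H2) (hsum H1 H2)
  *:%R hsum_map hsum_map_linear.

End HsumMap.

Section Representations.
Variables (R : realType) (A : starAlgType R).
Implicit Types (a b c : A) (u v w : A -> R[i]).

Lemma star_representation_sum (H1 H2 : hilbertType R)
    (pi1 : A -> {linear H1 -> H1}) (pi2 : A -> {linear H2 -> H2}) :
  star_representation pi1 -> star_representation pi2 ->
  star_representation
    (fun a => hsum_map (pi1 a) (pi2 a) : {linear hsum H1 H2 -> hsum H1 H2}).
Proof.
move=> [b1 l1 m1 s1] [b2 l2 m2 s2]; split.
- move=> a; apply/bounded_operator_nrm2.
  have [r1 r10 r1P] := (bounded_operator_nrm2 _).1 (b1 a).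
  have [r2 r20 r2P] := (bounded_operator_nrm2 _).1 (b2 a).
  exists (r1 + r2) => [|x]; first exact: addr_ge0.
  have hE (y : hsum H1 H2) : nrm2 y = nrm2 y.1 + nrm2 y.2.
    by rewrite /nrm2 /rdot hsumE raddfD.
  rewrite !hE /=; have := r1P x.1; have := r2P x.2.
  by have := nrm2_ge0 x.1; have := nrm2_ge0 x.2; nra.
- by move=> k a b x; rewrite /= /hsum_map l1 l2.
- by move=> a b x; rewrite /= /hsum_map m1 m2.
- by move=> a x y; rewrite !hsumE /= s1 s2.
Qed.

Section OneRepresentation.
Variables (H : hilbertType R) (pi : A -> {linear H -> H}).
Hypothesis piP : star_representation pi.

Let rdotP := @rdot_form R H.

Lemma srep_bounded a :
  exists2 r : R, 0 <= r & forall x, nrm2 (pi a x) <= r * nrm2 x.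
Proof. by case: piP => b _ _ _; apply/bounded_operator_nrm2. Qed.

Lemma srepP k a b x : pi (k *: a + b) x = k *: pi a x + pi b x.
Proof. by case: piP. Qed.

Lemma srepM a b x : pi (smul a b) x = pi a (pi b x).
Proof. by case: piP. Qed.

Lemma srep_star a x y : inner (pi a x) y = inner x (pi (star a) y).
Proof. by case: piP. Qed.

Lemma srepB a b x : pi (a - b) x = pi a x - pi b x.
Proof. by rewrite -scaleN1r addrC srepP scaleN1r addrC. Qed.

Lemma srep_subr a x y : pi a (x - y) = pi a x - pi a y.
Proof. exact: raddfB. Qed.

Lemma vector_state_sqval x u a : (forall b, u b = inner (pi b x) x) ->
  sqval u a = (nrm2 (pi a x))%:C.
Proof. by move=> uE; rewrite /sqval uE srepM srep_star starK innerxx. Qed.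

Lemma vector_state_representable x u : (forall b, u b = inner (pi b x) x) ->
  representable u.
Proof. by move=> uE; exists H, pi, x. Qed.

Lemma closed_range_invariant (L : A -> H) :
  (forall a b, pi a (L b) = L (smul a b)) ->
  forall a x, closed_range L x -> closed_range L (pi a x).
Proof.
move=> piL a x Lx e e0; have [r r0 rP] := srep_bounded a.
have r10 : 0 < r + 1 by rewrite ltr_wpDl.
have [b hb] := Lx _ (divr_gt0 e0 r10); exists (smul a b).
rewrite -piL -srep_subr (le_lt_trans (rP _)) //.
rewrite ltr_pdivlMr // in hb; have := nrm2_ge0 (x - L b).
by move: hb; rewrite mulrDr mulr1 mulrC; lra.
Qed.

Section Invariant.
Variable M : set H.
Hypotheses (MP : closed_submodule M) (Mpi : forall a x, M x -> M (pi a x)).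

Lemma invariant_proj_comm P : orthoproj M P ->
  forall a x, P (pi a x) = pi a (P x).
Proof.
move=> PP a; apply: (orthoproj_comm MP PP (B' := pi (star a))).
- by move=> x y; rewrite raddfB.
- by move=> x y; rewrite srep_star.
- exact: Mpi.
- exact: Mpi.
Qed.

(** Cross terms vanish because M and its orthogonal complement are invariant. *)
Lemma vector_state_split x y : M x -> (forall z, M z -> inner y z = 0) ->
  forall a, inner (pi a (x + y)) (x + y) =
            inner (pi a x) x + inner (pi a y) y.
Proof.
move=> Mx oy a; rewrite (raddfD (pi a)) innerDl !innerDr.
have -> : inner (pi a x) y = 0.
  by rewrite innerC oy ?rmorph0 //; exact: Mpi.
have -> : inner (pi a y) x = 0 by rewrite srep_star oy //; exact: Mpi.
by rewrite addr0 add0r.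
Qed.

End Invariant.

End OneRepresentation.

Lemma representable_scalar u : representable u -> scalar u.
Proof.
move=> [H [pi [x [piP uE]]]] k a b.
by rewrite !uE (srepP piP) innerDl innerZl.
Qed.

Lemma scalar_sub u a b : scalar u -> u (a - b) = u a - u b.
Proof. by move=> lu; rewrite -scaleN1r addrC lu mulN1r addrC. Qed.

Lemma scalarB u v : scalar u -> scalar v -> scalar (u - v).
Proof.
move=> lu lv k a b; rewrite !fctE lu lv mulrBr opprD.
by rewrite -!addrA; congr (_ + _); rewrite addrCA.
Qed.

Lemma representable_sqval_ge0 u a : representable u -> 0 <= sqval u a.
Proof.
move=> [H [pi [x [piP uE]]]].
by rewrite (vector_state_sqval piP _ uE) ler0c nrm2_ge0.
Qed.

Lemma fun_le_sqval u1 u2 a : fun_le u1 u2 -> sqval u1 a <= sqval u2 a.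
Proof. by move=> [_ /(_ a) h]; rewrite -subr_ge0; exact: h. Qed.

(** Polarization with a + b and a + i b. *)
Lemma sqval0_smul0 u : scalar u -> (forall a, sqval u a = 0) ->
  forall a b, u (smul a b) = 0.
Proof.
move=> lu u0; suff h a b : u (smul (star a) b) = 0.
  by move=> a b; rewrite -[a]starK h.
have uD x y : u (x + y) = u x + u y.
  by rewrite -[x]scale1r lu mul1r scale1r.
have u00 : u 0 = 0.
  by apply: (addrI (u 0)); rewrite -uD !addr0.
have uZ k x : u (k *: x) = k * u x.
  by rewrite -[k *: x]addr0 lu u00 addr0.
have := u0 (a + b); rewrite /sqval starD !(smulDl, smulDr) !uD.
rewrite -!/(sqval u _) !u0 add0r addr0 => e1.
have := u0 (a + 'i *: b); rewrite /sqval starD starZ.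
rewrite !(smulDl, smulDr, smulZl, smulZr) !uD !uZ -!/(sqval u _) !u0.
rewrite !mulr0 add0r addr0.
have -> : Num.conj ('i : R[i]) = - 'i.
  by apply/eqP; rewrite eq_complex /= oppr0 !eqxx.
rewrite mulNr -mulrBr => /eqP; rewrite mulf_eq0 => /orP[|/eqP e2].
  by rewrite eq_complex /= oner_eq0 andbF.
set p := u (smul (star a) b) in e1 e2 *; set q := u _ in e1 e2.
have : p *+ 2 = (p + q) + (p - q) by ring.
by rewrite e1 e2 addr0 => /eqP; rewrite mulrn_eq0 => /eqP.
Qed.

(** The values on squares fix those on products.  They fix u2 (a) as well,
    because a can be approximated by products a b: if pi b x is close to the
    projection of x onto the closure of pi A x, then pi (a - a b) x is close to
    0, and both functionals are continuous for the seminorm |pi a x|. *)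
Lemma representable_determined (H : hilbertType R) (pi : A -> {linear H -> H})
    (x : H) u1 u2 (C : R) :
  star_representation pi -> (forall a, u1 a = inner (pi a x) x) ->
  scalar u2 -> (forall a, sqmod (u2 a) <= C * nrm2 (pi a x)) ->
  (forall a, sqval u2 a = sqval u1 a) -> u2 = u1.
Proof.
move=> piP u1E lu2 bu2 e21.
have lu1 : scalar u1.
  by apply: representable_scalar; exact: (vector_state_representable piP u1E).
pose D := 2 * (`|C| + 2 * nrm2 x).
have D0 : 0 <= D by have := nrm2_ge0 x; have := normr_ge0 C; rewrite /D; lra.
have bd a : sqmod ((u2 - u1) a) <= D * nrm2 (pi a x).
  have b1 : sqmod (u1 a) <= 2 * nrm2 x * nrm2 (pi a x).
    by rewrite u1E; exact: inner_sqmod_le.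
  apply: le_trans (sqmodB_le _ _) _.
  have b2 : sqmod (u2 a) <= `|C| * nrm2 (pi a x).
    by apply: le_trans (bu2 a) _; rewrite ler_wpM2r ?nrm2_ge0 // ler_norm.
  by rewrite /D; lra.
have d0 := sqval0_smul0 (scalarB lu2 lu1).
have {}d0 a b : (u2 - u1) (smul a b) = 0.
  apply: d0 => {}a; rewrite /sqval !fctE; apply/eqP.
  by rewrite subr_eq0 -!/(sqval _ _) e21.
pose J a := pi a x.
have MP : closed_submodule (closed_range J).
  by apply: closed_range_submodule => k a b; exact: srepP.
have Minv a z : closed_range J z -> closed_range J (pi a z).
  by apply: (closed_range_invariant piP) => {}a b; rewrite /J srepM.
have [P PP] := orthoproj_exists MP.
apply/funext => a; apply/subr0_eq/sqmod_eq0/eqP.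
rewrite eq_le sqmod_ge0 andbT; apply/ler_addgt0Pl => e e0; rewrite addr0.
have [r r0 rP] := srep_bounded piP a.
have c0 : 0 < D * r + 1 by rewrite ltr_wpDl // mulr_ge0.
have [b hb] := orthoproj_in PP x _ (divr_gt0 e0 c0).
have -> : u2 a - u1 a = (u2 - u1) (a - smul a b).
  by rewrite (scalar_sub _ _ (scalarB lu2 lu1)) d0 subr0.
apply: le_trans (bd _) _.
have -> : pi (a - smul a b) x = pi a (P x - J b).
  rewrite (srepB piP) (srepM piP) srep_subr.
  rewrite -(invariant_proj_comm piP MP Minv PP).
  by rewrite (orthoproj_id MP PP) //; exact: closed_range_sub.
apply: le_trans (ler_wpM2l D0 (rP _)) _.
rewrite ltr_pdivlMr // in hb; have := nrm2_ge0 (P x - J b).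
by rewrite mulrA; move: (D * r) hb => s; lra.
Qed.

Lemma representable_sqval_inj u1 u2 : representable u1 -> representable u2 ->
  (forall a, sqval u1 a = sqval u2 a) -> u1 = u2.
Proof.
move=> [H1 [pi1 [x1 [piP1 u1E]]]] [H2 [pi2 [x2 [piP2 u2E]]]] e12.
have lu2 : scalar u2.
  by apply: representable_scalar; exact: (vector_state_representable piP2 u2E).
apply/esym; apply: (representable_determined (C := 2 * nrm2 x2) piP1 u1E lu2).
- move=> a; have := e12 a.
  rewrite (vector_state_sqval piP1 _ u1E) (vector_state_sqval piP2 _ u2E).
  by move=> /complexI ->; rewrite u2E; exact: inner_sqmod_le.
- by move=> a; rewrite e12.
Qed.

(** In the orthogonal sum, u(b^* b) + v(c^* c) with b + c = a is the squared
    distance from pi a (x1, 0) to the vector L c, so the infimum over c is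
    attained by the projection P onto the closure of the range of L.  As P
    commutes with pi, the residual of (x1, 0) represents the parallel sum, and
    P (x1, 0) represents the difference. *)
Lemma parallel_sum_exists u v : representable u -> representable v ->
  exists2 p, is_parallel_sum u v p & representable (u - p).
Proof.
move=> [H1 [pi1 [x1 [piP1 uE]]]] [H2 [pi2 [x2 [piP2 vE]]]].
pose pi a : {linear hsum H1 H2 -> hsum H1 H2} := hsum_map (pi1 a) (pi2 a).
have piP : star_representation pi by exact: star_representation_sum.
pose L c : hsum H1 H2 := (pi1 c x1, - pi2 c x2).
have Llin k c d : L (k *: c + d) = k *: L c + L d.
  by rewrite /L (srepP piP1) (srepP piP2) opprD -scalerN.
have piL a c : pi a (L c) = L (smul a c).
  by rewrite /L (srepM piP1) (srepM piP2) /pi /= /hsum_map /= raddfN.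
have MP := closed_range_submodule Llin.
have Minv := closed_range_invariant piP piL.
have [P PP] := orthoproj_exists MP.
pose xi : hsum H1 H2 := (x1, 0); pose eta := xi - P xi.
have uxi a : u a = inner (pi a xi) xi.
  by rewrite hsumE /= uE linear0r addr0.
have split a : u a = inner (pi a (P xi)) (P xi) + inner (pi a eta) eta.
  rewrite -(vector_state_split piP Minv (orthoproj_in PP xi)).
    by rewrite /eta addrC subrK.
  by move=> z; exact: (orthoproj_orth PP).
exists (fun a => inner (pi a eta) eta); last first.
  apply: (vector_state_representable piP (x := P xi)) => a.
  by rewrite !fctE split addrK.
split; first exact: (vector_state_representable piP (x := eta)).
move=> a; rewrite (vector_state_sqval piP (x := eta) a) //; congr _%:C.
have etaE : pi a eta = pi a xi - P (pi a xi).
  by rewrite /eta srep_subr (invariant_proj_comm piP MP Minv PP).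
have valE c : sqval u (a - c) + sqval v c = (nrm2 (pi a xi - L c))%:C.
  rewrite (vector_state_sqval piP1 _ uE) (vector_state_sqval piP2 _ vE).
  rewrite -rmorphD (srepB piP1); congr _%:C.
  rewrite /nrm2 /rdot hsumE [RHS]raddfD /=.
  by rewrite raddf0 sub0r opprK.
rewrite etaE; apply/esym/inf_approx.
  move=> _ [b [c [bc ->]]].
  have -> : b = a - c by rewrite -bc addrK.
  rewrite valE /=.
  set y := pi _ xi; rewrite (orthoproj_pythagoras PP (y - L c)).
  have -> : y - L c - P (y - L c) = y - P y.
    have Plin := symopB (orthoproj_sym PP).
    rewrite Plin (orthoproj_id MP PP (closed_range_sub _ c)).
    by rewrite opprB addrA subrK.
  by rewrite lerDr nrm2_ge0.
move=> e e0; have [c hc] := orthoproj_in PP (pi a xi) _ e0.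
exists (nrm2 (pi a xi - L c)).
  by exists (a - c), c; rewrite subrK valE.
rewrite (orthoproj_pythagoras PP) addrC.
have Plin := symopB (orthoproj_sym PP).
rewrite Plin (orthoproj_id MP PP (closed_range_sub _ c)).
rewrite opprB [pi a xi - L c + _]addrA subrK.
by rewrite ltrD2l.
Qed.

Lemma parallel_sumP u v : representable u -> representable v ->
  is_parallel_sum u v (parallel_sum u v) /\
  representable (u - parallel_sum u v).
Proof.
move=> ru rv; have [p pP rp] := parallel_sum_exists ru rv.
suff -> : parallel_sum u v = p by [].
have := xgetPex 0 (ex_intro _ p pP : exists x, is_parallel_sum u v x).
rewrite -/(parallel_sum u v); move: (parallel_sum u v) pP => q [rpp pE] [rq qE].
by apply: representable_sqval_inj => // a; rewrite qE pE.
Qed.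

End Representations.

(** * The Lebesgue decomposition *)

Section Convergence.
Variable R : realType.

Lemma complex_cvg0P (T : Type) (F : set_system T) (FF : Filter F) (f : T -> R) :
  (f x)%:C @[x --> F] --> (0 : R[i]) <->
  forall e : R, 0 < e -> \forall x \near F, `|f x| < e.
Proof.
have nE (r : R) : `|r%:C| = (`|r|)%:C :> R[i].
  by rewrite normc_def /= expr0n addr0 sqrtr_sqr.
split=> [/cvgr0Pnorm_lt h e e0|h].
  have := h e%:C; rewrite ltcR => /(_ e0).
  by apply: filterS => x; rewrite nE ltcR.
apply/cvgr0Pnorm_lt => _ /gt0_complexE[e e0 ->].
by apply: filterS (h e e0) => x; rewrite nE ltcR.
Qed.

Lemma near_nat2P (P : nat -> nat -> Prop) :
  (\forall p \near (\oo, \oo), P p.1 p.2) <->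
  exists N, forall n m, (N <= n)%N -> (N <= m)%N -> P n m.
Proof.
split=> [[[B C] /= [[N1 _ N1B] [N2 _ N2C]] BC]|[N HN]].
  exists (maxn N1 N2) => n m; rewrite !geq_max => /andP[n1 n2] /andP[m1 m2].
  by apply: (BC (n, m)); split; [exact: N1B | exact: N2C].
exists ([set n | (N <= n)%N], [set n | (N <= n)%N]) => /=.
  by split; exists N.
by move=> [n m] /= [? ?]; exact: HN.
Qed.

End Convergence.

Section Lebesgue.
Variables (R : realType) (A : starAlgType R).
Implicit Types (a b c : A) (u : A -> R[i]).

Variables (H1 H2 : hilbertType R).
Variables (pi1 : A -> {linear H1 -> H1}) (pi2 : A -> {linear H2 -> H2}).
Variables (x1 : H1) (x2 : H2) (w v : A -> R[i]).
Hypotheses (pi1P : star_representation pi1) (pi2P : star_representation pi2).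
Hypotheses (wE : forall a, w a = inner (pi1 a x1) x1)
           (vE : forall a, v a = inner (pi2 a x2) x2).

Let K : hilbertType R := hsum H1 H2.
Let pi a : {linear K -> K} := hsum_map (pi1 a) (pi2 a).
Let zeta : K := (x1, x2).
Let J a : K := pi a zeta.
Let E1 (x : K) : K := (x.1, 0).
Let G : set K := closed_range J.

Let rdotP := @rdot_form R K.

Let piP : star_representation pi.
Proof. exact: star_representation_sum. Qed.

Let GP : closed_submodule G.
Proof. by apply: closed_range_submodule => k a b; exact: srepP. Qed.

Let Ginv a x : G x -> G (pi a x).
Proof. by apply: (closed_range_invariant piP) => {}a b; rewrite /J srepM. Qed.

Let nrm2E (x : K) : nrm2 x = nrm2 x.1 + nrm2 x.2.
Proof. by rewrite /nrm2 /rdot hsumE raddfD. Qed.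

Let JB a b : J (a - b) = J a - J b.
Proof. exact: srepB. Qed.

Let wJ a : sqval w a = (nrm2 (J a).1)%:C.
Proof. by rewrite (vector_state_sqval pi1P _ wE). Qed.

Let vJ a : sqval v a = (nrm2 (J a).2)%:C.
Proof. by rewrite (vector_state_sqval pi2P _ vE). Qed.

Section GraphProjection.
Variable Q : K -> K.
Hypothesis QP : orthoproj G Q.

Let Qsym := orthoproj_sym QP.

Let W x : K := Q (E1 (Q x)).

Let E1sym : symop E1.
Proof. by move=> x y; rewrite !hsumE /= linear0l linear0r. Qed.

Let Wsym : symop W.
Proof. by move=> x y; rewrite /W Qsym E1sym Qsym. Qed.

Let W_rdot x : rdot (W x) x = nrm2 (Q x).1.
Proof.
rewrite /W (symop_rdot Qsym) /nrm2 /rdot hsumE /=.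
by rewrite linear0l addr0.
Qed.

Let Q_nrm2_le x : nrm2 (Q x) <= nrm2 x.
Proof. by rewrite [leRHS](orthoproj_pythagoras QP) lerDl nrm2_ge0. Qed.

Let W01 x : 0 <= rdot (W x) x <= nrm2 x.
Proof.
rewrite W_rdot nrm2_ge0 (le_trans _ (Q_nrm2_le x)) //.
by rewrite nrm2E lerDl nrm2_ge0.
Qed.

Let WG x : G (W x).
Proof. exact: (orthoproj_in QP). Qed.

Let Wpi a x : W (pi a x) = pi a (W x).
Proof.
have QC := invariant_proj_comm piP GP Ginv QP.
rewrite /W (QC a x) -(QC a (E1 (Q x))); congr Q.
by rewrite /E1 /pi /= /hsum_map /= linear0.
Qed.

Let QJ a : Q (J a) = J a.
Proof. by apply: (orthoproj_id GP QP); exact: closed_range_sub. Qed.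

(** If W x = x then Q and E1 cannot shorten x, so x lies in G and in H1. *)
Let fixP x : W x = x <-> G x /\ x.2 = 0.
Proof.
split=> [Wx|[Gx x20]].
  have Gx : G x by rewrite -Wx; exact: WG.
  split=> //; apply: nrm2_eq0.
  have := W_rdot x; rewrite Wx (orthoproj_id GP QP Gx) -/(nrm2 x) nrm2E => e.
  by apply: (addrI (nrm2 x.1)); rewrite e addr0.
rewrite /W (orthoproj_id GP QP Gx).
have -> : E1 x = x by rewrite [RHS]surjective_pairing x20.
exact: (orthoproj_id GP QP Gx).
Qed.

Let N : set K := [set x | W x = x].

Let NP : closed_submodule N.
Proof. exact: fixed_submodule. Qed.

Let Ninv a x : N x -> N (pi a x).
Proof. by rewrite /N /= Wpi => ->. Qed.

Section Decomposition.
Variable P : K -> K.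
Hypothesis PP : orthoproj N P.

Let Psym := orthoproj_sym PP.

Let Ppi a x : P (pi a x) = pi a (P x).
Proof. exact: (invariant_proj_comm piP NP Ninv PP). Qed.

Let PG x : G (P x).
Proof. by have [] := (fixP (P x)).1 (orthoproj_in PP x). Qed.

Let P2 x : (P x).2 = 0.
Proof. by have [] := (fixP (P x)).1 (orthoproj_in PP x). Qed.

(** The candidate for the limit; singular_partE below identifies it. *)
Let ws a : R[i] := inner (pi a (P zeta)) (P zeta).

Let wsJ a : sqval ws a = (nrm2 (P (J a)))%:C.
Proof. by rewrite (vector_state_sqval piP (x := P zeta)) // -Ppi. Qed.

Variable T_ : nat -> K -> K.
Hypotheses (T_0 : T_ 0%N = W) (T_adm : forall n, admissible W G (T_ n))
           (T_step : forall n, parallel_step W G (T_ n) (T_ n.+1)).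

(** The infimum defining the parallel sum runs over J c only; since the
    minimizer c0 lies in G, the closure of these vectors, the infimum is the
    drop of parallel_step. *)
Lemma iterate_representable n : representable (iter n (mu_tilde v) w) /\
  forall a, sqval (iter n (mu_tilde v) w) a = (rdot (T_ n (J a)) (J a))%:C.
Proof.
have rv : representable v by exact: (vector_state_representable pi2P vE).
elim: n => [|n [ru uJ]].
  split; first exact: (vector_state_representable pi1P wE).
  by move=> a; rewrite T_0 W_rdot QJ wJ.
have [[rp pJ] rq] := parallel_sumP ru rv; split=> // a.
rewrite /= /mu_tilde; set u := iter n _ w in ru uJ rp pJ rq *.
have -> : sqval (u - parallel_sum u v) a =
    sqval u a - sqval (parallel_sum u v) a by [].
rewrite uJ pJ -rmorphB; congr _%:C.
set I := inf _.
suff -> : I = rdot (T_ n (J a)) (J a) - rdot (T_ n.+1 (J a)) (J a).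
  by rewrite opprB addrC subrK.
have [c0 Gc0 c0P] := T_step n (J a).
have valE c : sqval u (a - c) + sqval v c =
    (rdot (T_ n (J a)) (J a) - rdot (T_ n.+1 (J a)) (J a) +
     energy W (T_ n) (J c - c0))%:C.
  rewrite -c0P uJ vJ -rmorphD JB (rfDl rdotP (J c)) (rfNl rdotP).
  by rewrite W_rdot QJ -/(nrm2 (J c)) (nrm2E (J c)) addrAC subrr add0r.
have V0 x : 0 <= rdot (x - W x) x <= nrm2 x.
  rewrite (rfDl rdotP) (rfNl rdotP) -/(nrm2 x).
  by have /andP[h1 h2] := W01 x; rewrite subr_ge0 h2 gerBl h1.
have E0 x : 0 <= energy W (T_ n) x <= 2 * nrm2 x.
  have /andP[h1 h2] := adm01 (T_adm n) x; have /andP[h3 h4] := V0 x.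
  by rewrite /energy addr_ge0 //= mulr_natl mulr2n lerD.
apply: inf_approx.
  move=> _ [b [c [bc ->]]].
  have -> : b = a - c by rewrite -bc addrK.
  rewrite valE /= lerDl; by have /andP[] := E0 (J c - c0).
move=> e e0; have e20 : 0 < e / 2 by rewrite divr_gt0.
have [c hc] := Gc0 _ e20.
eexists; first by exists (a - c), c; rewrite subrK valE.
rewrite /= ltrD2l; have /andP[_ h] := E0 (J c - c0).
by apply: le_lt_trans h _; rewrite nrm2C mulrC -ltr_pdivlMr.
Qed.

(** Both sides agree on squares, and T_n commutes with pi. *)
Lemma iterateE n a : iter n (mu_tilde v) w a = inner (T_ n (J a)) zeta.
Proof.
have [[H [rho [y [rhoP uE]]]] uJ] := iterate_representable n.
have Tsym := adm_sym (T_adm n).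
have Tpi b x : T_ n (pi b x) = pi b (T_ n x).
  by apply/esym/(admC (T_adm n)) => {}x; [exact: srep_subr | rewrite Wpi].
suff <- : (fun a => inner (T_ n (J a)) zeta) = iter n (mu_tilde v) w by [].
have hy b : nrm2 (rho b y) = rdot (T_ n (J b)) (J b).
  by apply: complexI; rewrite -uJ (vector_state_sqval rhoP _ uE).
apply: (representable_determined (C := 2 * nrm2 zeta) rhoP uE).
- by move=> k b c; rewrite /J (srepP piP) (symop_lin Tsym) innerDl innerZl.
- move=> b; rewrite hy.
  exact: symop_sqmod_le Tsym (adm01 (T_adm n)) _ _.
- move=> b; rewrite uJ /sqval /J (srepM piP) Tpi (srep_star piP) starK.
  exact: symop_real.
Qed.

(** The difference with the limit is (D (J a) | zeta) with D = T_n - P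
    positive, so it is controlled by (D (J a), J a), which tends to 0. *)
Lemma iterate_cvg a : iter n (mu_tilde v) w a @[n --> \oo] --> ws a.
Proof.
have wsE : ws a = inner (P (J a)) zeta.
  by rewrite /ws -Ppi Psym (orthoproj_idem NP PP) -Psym.
apply/cvgrPdist_lt => _ /gt0_complexE[e e0 ->].
have c0 : 0 < 2 * nrm2 zeta + 1 by have := nrm2_ge0 zeta; lra.
have d0 : 0 < e ^+ 2 / (2 * nrm2 zeta + 1) by rewrite divr_gt0 // exprn_gt0.
have [n0 Hn0] := iterate_limit Wsym W01 T_adm T_step PP (J a) d0.
exists n0 => // n /= le_n; rewrite distrC normr_lt_sqmod // iterateE wsE.
rewrite -innerNl -innerDl.
have low x : nrm2 (P x) <= rdot (T_ n x) x by exact: (iterate_lower T_adm PP).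
have hPE x : nrm2 (P x) = rdot (P x) x.
  by rewrite /nrm2 (symop_rdot Psym) (orthoproj_idem NP PP) (symop_rdot Psym).
pose D x := T_ n x - P x.
have Dsym : symop D.
  move=> x y; rewrite /D innerDl innerDr innerNl innerNr Psym.
  by rewrite (adm_sym (T_adm n)).
have DE x : rdot (D x) x = rdot (T_ n x) x - nrm2 (P x).
  by rewrite (rfDl rdotP) (rfNl rdotP) hPE.
have D0 x : 0 <= rdot (D x) x by rewrite DE subr_ge0.
have D01 x : 0 <= rdot (D x) x <= nrm2 x.
  rewrite D0 DE; have /andP[_] := adm01 (T_adm n) x.
  by have := nrm2_ge0 (P x); lra.
apply: le_lt_trans (symop_sqmod_le Dsym D01 _ _) _.
have := Hn0 _ le_n; rewrite -ltrBlDl -DE ltr_pdivlMr //.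
by have := D0 (J a); lra.
Qed.

Lemma singular_partE : singular_part v w = ws.
Proof.
apply/funext => a; apply/cvg_lim; last exact: iterate_cvg.
exact: norm_hausdorff.
Qed.


Let E1B x y : E1 (x - y) = E1 x - E1 y.
Proof. exact: (symopB E1sym). Qed.

Let PB x y : P (x - y) = P x - P y.
Proof. exact: (symopB Psym). Qed.

Let E1P x : E1 (P x) = P x.
Proof. by rewrite [RHS]surjective_pairing P2. Qed.

Let PE1 x : P (E1 x) = P x.
Proof. by apply: inner_ext => y; rewrite Psym E1sym E1P Psym. Qed.

Let nrm2_E1 (x : K) : nrm2 (E1 x) = nrm2 x.1.
Proof. by rewrite nrm2E nrm2_0 addr0. Qed.

Let nrm2_P_le x : nrm2 (P x) <= nrm2 x.
Proof. by rewrite [leRHS](orthoproj_pythagoras PP) lerDl nrm2_ge0. Qed.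

Let xr : K := E1 zeta - P zeta.

Lemma regular_partE a : (w - ws) a = inner (pi a xr) xr.
Proof.
have split : w a = ws a + inner (pi a xr) xr.
  rewrite -(vector_state_split piP Ninv (orthoproj_in PP zeta)); last first.
    by move=> z Nz; rewrite /xr -PE1; exact: (orthoproj_orth PP).
  have -> : P zeta + xr = E1 zeta by rewrite /xr addrC subrK.
  by rewrite hsumE /= wE linear0r addr0.
by rewrite !fctE split addrC addKr.
Qed.

Lemma regular_part_sqval a : sqval (w - ws) a = (nrm2 (E1 (J a) - P (J a)))%:C.
Proof.
rewrite (vector_state_sqval piP (x := xr) a regular_partE).
rewrite /xr (srep_subr pi) -Ppi.
have -> // : pi a (E1 zeta) = E1 (J a).
by rewrite /pi /= /hsum_map /= linear0.
Qed.

(** P (J a) has second component 0, so approximants of it from the range of J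
    are small for v. *)
Lemma approx_singular a (e : R) : 0 < e ->
  exists2 b, nrm2 (P (J a) - J b) < e & nrm2 (J b).2 < e.
Proof.
move=> e0; have [b hb] := PG (J a) e0; exists b => //.
apply: le_lt_trans hb; rewrite (nrm2E (P _ - _)) /= P2 sub0r nrm2N.
by rewrite lerDr nrm2_ge0.
Qed.

(** Below w_s and v, u is small on a - b by the first bound and on b by the
    second, with b as in approx_singular. *)
Lemma ws_singular : mutually_singular ws v.
Proof.
move=> u ru uws uv; have [H [rho [y [rhoP uE]]]] := ru.
have uJ a : sqval u a = (nrm2 (rho a y))%:C by exact: vector_state_sqval.
have r0 : representable (0 : A -> R[i]).
  by apply: (vector_state_representable rhoP (x := 0)) => a; rewrite linear0r.
apply: representable_sqval_inj => // a; rewrite uJ.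
suff h : nrm2 (rho a y) <= 0.
  by congr _%:C; apply/eqP; rewrite eq_le h nrm2_ge0.
apply/ler_addgt0Pl => e e0; rewrite addr0.
have e40 : 0 < e / 4 by rewrite divr_gt0.
have [b hb vb] := approx_singular a e40.
have -> : rho a y = rho (a - b) y + rho b y by rewrite (srepB rhoP) subrK.
apply/ltW/nrm2D_lt.
  rewrite -ltcR -uJ; apply: le_lt_trans (fun_le_sqval _ uws) _.
  rewrite wsJ ltcR; apply: le_lt_trans hb.
  by rewrite JB PB -{1}(orthoproj_idem NP PP) -PB.
by rewrite -ltcR -uJ; apply: le_lt_trans (fun_le_sqval _ uv) _; rewrite vJ ltcR.
Qed.

(** Let l be the limit of (E1 - P) J a_n.  As v(a_n^* a_n) --> 0, it is also the
    limit of (1 - P) J a_n, a sequence in G orthogonal to N with second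
    components tending to 0.  Hence l is in N and orthogonal to N. *)
Lemma regular_part_abs_continuous : abs_continuous (w - ws) v.
Proof.
move=> a_ cv cw.
have {}cv e : 0 < e -> exists N, forall n, (N <= n)%N -> nrm2 (J (a_ n)).2 < e.
  move=> e0; have := cv; under eq_fun do rewrite vJ.
  move=> /complex_cvg0P/(_ e e0) [N0 _ HN]; exists N0 => n le_n.
  by have := HN n le_n; rewrite /= ger0_norm ?nrm2_ge0.
pose x n := E1 (J (a_ n)) - P (J (a_ n)).
have xB n m : E1 (J (a_ n - a_ m)) - P (J (a_ n - a_ m)) = x n - x m.
  by rewrite JB E1B PB /x !opprD !opprK addrACA.
have {}cw e : 0 < e -> exists N, forall n m, (N <= n)%N -> (N <= m)%N ->
    nrm2 (x n - x m) < e.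
  move=> e0; apply/(near_nat2P (fun n m => nrm2 (x n - x m) < e)).
  have := cw; under eq_fun do rewrite regular_part_sqval.
  move=> /complex_cvg0P/(_ e e0); apply: filterS => -[n m] /=.
  by rewrite xB ger0_norm ?nrm2_ge0.
have [l lP] := hilbert_complete cw.
have xE n : x n = (J (a_ n) - P (J (a_ n))) - (J (a_ n) - E1 (J (a_ n))).
  by rewrite opprB [RHS]addrC addrA subrK.
have h2 (z : K) : nrm2 (z - E1 z) = nrm2 z.2.
  by rewrite nrm2E /= subrr nrm2_0 add0r subr0.
have near_l e : 0 < e -> exists N, forall n, (N <= n)%N ->
    nrm2 (l - (J (a_ n) - P (J (a_ n)))) < e.
  move=> e0; have e40 : 0 < e / 4 by rewrite divr_gt0.
  have [N1 HN1] := cv _ e40; have [N2 HN2] := lP _ e40.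
  exists (maxn N1 N2) => n; rewrite geq_max => /andP[n1 n2].
  have -> : l - (J (a_ n) - P (J (a_ n))) =
      (l - x n) + - (J (a_ n) - E1 (J (a_ n))).
    rewrite xE; move: (J _ - P _) (J _ - E1 _) => p q.
    by rewrite opprD opprK addrA addrK.
  by apply: nrm2D_lt; [exact: HN2 | rewrite nrm2N h2; exact: HN1].
have Gl : G l.
  apply: (cs_closed GP) => e e0; have [n0 Hn0] := near_l e e0.
  exists (J (a_ n0) - P (J (a_ n0))); last exact: Hn0.
  by apply: (csB GP); [exact: closed_range_sub | exact: PG].
have l2 : l.2 = 0.
  apply/nrm2_eq0/eqP; rewrite eq_le nrm2_ge0 andbT.
  apply/ler_addgt0Pl => e e0; rewrite addr0.
  have e40 : 0 < e / 4 by rewrite divr_gt0.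
  have [N1 HN1] := cv _ e40; have [N3 HN3] := near_l _ e40.
  pose n := maxn N1 N3; rewrite -(subrK (J (a_ n)).2 l.2).
  apply/ltW/nrm2D_lt; last by apply: HN1; rewrite leq_maxl.
  apply: le_lt_trans (HN3 n (leq_maxr _ _)).
  by rewrite [leRHS]nrm2E /= P2 subr0 lerDr nrm2_ge0.
have Pl0 : P l = 0.
  apply/nrm2_eq0/eqP; rewrite eq_le nrm2_ge0 andbT.
  apply/ler_addgt0Pl => e e0; rewrite addr0.
  have [n0 Hn0] := near_l _ e0.
  apply: ltW; apply: le_lt_trans (Hn0 _ (leqnn _)).
  apply: le_trans (nrm2_P_le _).
  by rewrite !PB (orthoproj_idem NP PP) subrr subr0.
have l0 : l = 0.
  by rewrite -Pl0; apply/esym/(orthoproj_id NP PP)/fixP.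
under eq_fun do rewrite regular_part_sqval.
apply/complex_cvg0P => e e0.
have [n0 Hn0] := lP e e0; exists n0 => // n /= le_n.
by have := Hn0 n le_n; rewrite l0 sub0r nrm2N ger0_norm ?nrm2_ge0.
Qed.

(** For b_n with J b_n --> P (J a), u <= w makes b_n a Cauchy sequence for u and
    v(b_n^* b_n) --> 0, so u << v gives u(b_n^* b_n) --> 0.  Thus u(a^* a) is
    approximated by u((a - b_n)^* (a - b_n)), at most
    w((a - b_n)^* (a - b_n)) --> |E1 (J a) - P (J a)|^2. *)
Lemma regular_part_largest u : representable u -> fun_le u w ->
  abs_continuous u v -> fun_le u (w - ws).
Proof.
move=> ru uw uv; have [H [rho [y [rhoP uE]]]] := ru.
have uJ a : sqval u a = (nrm2 (rho a y))%:C by exact: vector_state_sqval.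
have ule a : nrm2 (rho a y) <= nrm2 (J a).1.
  by rewrite -lecR -uJ -wJ; exact: fun_le_sqval.
split.
  apply: scalarB; last exact: representable_scalar.
  apply: representable_scalar.
  exact: (vector_state_representable piP (x := xr) regular_partE).
move=> a; have -> : sqval (w - ws - u) a = sqval (w - ws) a - sqval u a by [].
rewrite regular_part_sqval uJ subr_ge0 lecR.
have /choice[b_ bP] : forall n, exists b,
    nrm2 (P (J a) - J b) < n.+1%:R^-1 /\ nrm2 (J b).2 < n.+1%:R^-1.
  move=> n; have n0 : 0 < n.+1%:R^-1 :> R by rewrite invr_gt0 ltr0n.
  by have [b ? ?] := approx_singular a n0; exists b.
have ub : sqval u (b_ n) @[n --> \oo] --> (0 : R[i]).
  apply: uv.
    under eq_fun do rewrite vJ.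
    apply/complex_cvg0P => e e0; have [n0 Hn0] := natinv_lt e0.
    exists n0 => // n /= le_n; rewrite ger0_norm ?nrm2_ge0 //.
    exact: lt_trans (bP n).2 (Hn0 n le_n).
  under eq_fun do rewrite uJ.
  apply/complex_cvg0P => e e0; have e40 : 0 < e / 4 by rewrite divr_gt0.
  apply/(near_nat2P (fun n m => `|nrm2 (rho (b_ n - b_ m) y)| < e)).
  have [n0 Hn0] := natinv_lt e40; exists n0 => n m le_n le_m.
  rewrite ger0_norm ?nrm2_ge0 //; apply: le_lt_trans (ule _) _.
  have -> : (J (b_ n - b_ m)).1 =
      (J (b_ n) - P (J a)).1 + (P (J a) - J (b_ m)).1.
    by rewrite JB /= addrA subrK.
  have h1 (z : K) : nrm2 z.1 <= nrm2 z by rewrite [leRHS]nrm2E lerDl nrm2_ge0.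
  apply: nrm2D_lt; apply: le_lt_trans (h1 _) _.
    by rewrite nrm2C; exact: lt_trans (bP n).1 (Hn0 n le_n).
  exact: lt_trans (bP m).1 (Hn0 m le_m).
move: ub; under eq_fun do rewrite uJ; move/complex_cvg0P => ub.
apply: nrm2_le_approx => e e0.
have [d d0 dP] := nrm2_upper_continuous (E1 (J a) - P (J a)) e0.
have [n1 Hn1] := natinv_lt d0; have [n2 _ Hn2] := ub _ e0.
pose n := maxn n1 n2; exists (rho (a - b_ n) y).
  rewrite -(srepB rhoP) opprB addrC subrK.
  by have := Hn2 n (leq_maxr _ _); rewrite /= ger0_norm ?nrm2_ge0.
apply: le_trans (ule _) _.
have -> : nrm2 (J (a - b_ n)).1 =
    nrm2 ((E1 (J a) - P (J a)) + E1 (P (J a) - J (b_ n))).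
  by rewrite -nrm2_E1 JB !E1B E1P addrA subrK.
apply: dP; rewrite nrm2_E1.
apply: le_lt_trans (lt_trans (bP n).1 (Hn1 n (leq_maxl _ _))).
by rewrite [leRHS]nrm2E lerDl nrm2_ge0.
Qed.

Lemma lebesgue_of_projection :
  lebesgue_decomposition w v ws (w - ws) /\
  is_maximum [set u : A -> R[i] |
      [/\ representable u, fun_le u w & abs_continuous u v]] (w - ws).
Proof.
have rs : representable ws.
  exact: (vector_state_representable piP (x := P zeta)).
have rr : representable (w - ws).
  exact: (vector_state_representable piP (x := xr) regular_partE).
have ac := regular_part_abs_continuous.
split; first by split=> //; [rewrite addrC subrK | exact: ws_singular].
split=> [|u [ru uw uv]]; last exact: regular_part_largest.
split=> //; rewrite /fun_le opprB addrC subrK.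
split; first exact: representable_scalar.
by move=> a; exact: representable_sqval_ge0.
Qed.

End Decomposition.

Lemma lebesgue_of_graph_projection : let ws := singular_part v w in
  lebesgue_decomposition w v ws (w - ws) /\
  is_maximum [set u : A -> R[i] |
      [/\ representable u, fun_le u w & abs_continuous u v]] (w - ws).
Proof.
have [P PP] := orthoproj_exists NP.
have [T_ [T_0 T_adm T_step]] := admissible_seq Wsym W01 WG.
rewrite /= (singular_partE PP T_0 T_adm T_step).
exact: lebesgue_of_projection.
Qed.

End GraphProjection.

Lemma lebesgue_of_representations : let ws := singular_part v w in
  lebesgue_decomposition w v ws (w - ws) /\
  is_maximum [set u : A -> R[i] |
      [/\ representable u, fun_le u w & abs_continuous u v]] (w - ws).
Proof.
have [Q QP] := orthoproj_exists GP.
exact: lebesgue_of_graph_projection QP.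
Qed.

End Lebesgue.

Theorem theorem4p3 (R : realType) (A : starAlgType R) (v w : A -> R[i])
    (hv : representable v) (hw : representable w) :
  let ws := singular_part v w in
  lebesgue_decomposition w v ws (w - ws) /\
  is_maximum [set u : A -> R[i] |
      [/\ representable u, fun_le u w & abs_continuous u v]] (w - ws).
Proof.
have [H2 [pi2 [x2 [pi2P vE]]]] := hv; have [H1 [pi1 [x1 [pi1P wE]]]] := hw.
exact: (lebesgue_of_representations pi1P pi2P wE vE).
Qed.
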